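(* Let $(R,\mathfrak{m})$ be a complete Noetherian local ring of dimension $d>0$, and let $\mathfrak{a}$ and $\mathfrak{b}$ be two ideals of $R$ which are linked by the zero ideal, such that $\operatorname{cd}(\mathfrak{a},R)=d$. Then the following statements hold. (i) $\sqrt{0:_R H^d_{\mathfrak{a}}(R)}$ is a linked ideal. (ii) If $R$ is unmixed and $\mathfrak{a}+\mathfrak{b}$ is $\mathfrak{m}$-primary, then $0:_R H^d_{\mathfrak{a}}(R)=\mathfrak{b}$ and $0:_R H^d_{\mathfrak{b}}(R)=\mathfrak{a}$.
   Context: Two non-zero proper ideals $\mathfrak{a},\mathfrak{b}$ of $R$ are linked by an ideal $I\subseteq\mathfrak{a}\cap\mathfrak{b}$ generated by an $R$-regular sequence (possibly empty, so $I=0$ is allowed) if $\mathfrak{b}=I:_R\mathfrak{a}$ and $\mathfrak{a}=I:_R\mathfrak{b}$; in particular, being linked by the zero ideal means $\mathfrak{b}=0:_R\mathfrak{a}$ and $\mathfrak{a}=0:_R\mathfrak{b}$. An ideal is a linked ideal if it is linked to some ideal by some such $I$. $H^i_{\mathfrak{a}}(R)$ denotes the $i$-th local cohomology module of $R$ with support in $\mathfrak{a}$, $\operatorname{cd}(\mathfrak{a},R)=\sup\{i: H^i_{\mathfrak{a}}(R)\neq 0\}$, and $0:_R H$ is the annihilator of $H$. The local ring $R$ is unmixed if $\dim R/\mathfrak{p}=\dim R$ for all $\mathfrak{p}\in\operatorname{Ass} R$. *)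

(* Defs.v *)
From HB Require Import structures.
From mathcomp Require Import all_boot all_order all_algebra.
From mathcomp Require Import ring_quotient.
From mathcomp Require Import boolp classical_sets.
Set Implicit Arguments.
Unset Strict Implicit.
Unset Printing Implicit Defensive.
Import GRing.Theory.
Local Open Scope classical_set_scope.
Local Open Scope ring_scope.

(* The supremum of a set of naturals is the natural number n exactly when n
   is its greatest element; the suprema of the empty set (-oo) and of
   unbounded sets (+oo) are equal to no n. *)
Definition sup_is (S : set nat) (n : nat) : Prop :=
  S n /\ forall k, S k -> (k <= n)%N.

Section Ideals.
Variable R : comNzRingType.
Implicit Types (I J a b m p q : set R) (s : seq R).

Definition is_ideal I : Prop := submod_closed (mem (I : set R^o)).

(* MathComp's idealr_closed includes 1 \notin I. *)
Definition is_proper_ideal I : Prop := idealr_closed (mem I).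

Definition is_prime_ideal p : Prop :=
  is_proper_ideal p /\ prime_idealr_closed (mem p).

Definition is_maximal_ideal m : Prop :=
  is_proper_ideal m /\ forall J, is_proper_ideal J -> m `<=` J -> J = m.

Definition ideal_gen (A : set R) : set R := smallest is_ideal A.

Definition ideal_add I J : set R := [set x + y | x in I & y in J].

Definition ideal_mul I J : set R := ideal_gen [set x * y | x in I & y in J].

Fixpoint ideal_pow I (n : nat) : set R :=
  if n is n'.+1 then ideal_mul I (ideal_pow I n') else setT.

Definition colon I J : set R := [set r | forall x, J x -> I (r * x)].

Definition radical I : set R := [set r | exists n, I (r ^+ n)].

Definition is_primary_ideal q : Prop :=
  is_proper_ideal q /\
  forall x y, q (x * y) -> q x \/ radical q y.

Definition is_primary_to m q : Prop := is_primary_ideal q /\ radical q = m.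

Definition associated_prime p : Prop :=
  is_prime_ideal p /\ exists x : R, p = colon [set 0] [set x].

Definition regular_sequence s : Prop :=
  (forall i, (i < size s)%N -> forall r,
     ideal_gen [set` take i s] (s`_i * r) -> ideal_gen [set` take i s] r)
  /\ ~ ideal_gen [set` s] 1.

Definition linked_by I a b : Prop :=
  [/\ is_proper_ideal a /\ a <> [set 0],
      is_proper_ideal b /\ b <> [set 0],
      exists2 s, regular_sequence s & I = ideal_gen [set` s],
      I `<=` a `&` b
    & b = colon I a /\ a = colon I b].

Definition linked_ideal a : Prop := exists I b, linked_by I a b.

End Ideals.

Section Rings.
Implicit Type R : comNzRingType.

Definition noetherian R : Prop :=
  forall I : set R, is_ideal I -> exists s : seq R, I = ideal_gen [set` s].

Definition local_ring R (m : set R) : Prop :=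
  is_maximal_ideal m /\ forall n : set R, is_maximal_ideal n -> n = m.

(* The canonical map from R to the inverse limit of the R / m^n is bijective:
   every compatible sequence of residue classes has exactly one lift. *)
Definition adically_complete R (m : set R) : Prop :=
  (forall x, (forall n, ideal_pow m n x) -> x = 0) /\
  (forall u : nat -> R, (forall n, ideal_pow m n (u n.+1 - u n)) ->
     exists l, forall n, ideal_pow m n (u n - l)).

Definition prime_chain R (n : nat) : Prop :=
  exists p : 'I_n.+1 -> set R,
    (forall i, is_prime_ideal (p i)) /\
    (forall i j : 'I_n.+1, (i < j)%N -> p i `<` p j).

Definition krull_dim_is R (n : nat) : Prop := sup_is (prime_chain R) n.

End Rings.

Section QuotientRing.
Variables (R : comNzRingType) (I : set R) (Iproper : is_proper_ideal I).

(* The unused argument Iproper is what makes the instances below canonical. *)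
Definition ideal_mem of is_proper_ideal I : {pred R} := fun x => x \in I.

HB.instance Definition _ :=
  isIdealr.Build R (ideal_mem Iproper) Iproper.

Definition quotient_ring : comNzRingType :=
  {ideal_quot (ideal_mem Iproper : idealr R)}.

End QuotientRing.

Definition unmixed (R : comNzRingType) : Prop :=
  forall (p : set R) (pproper : is_proper_ideal p), associated_prime p ->
  forall n, krull_dim_is (quotient_ring pproper) n <-> krull_dim_is R n.

Definition annihilator (R : comNzRingType) (M : lmodType R) : set R :=
  [set r | forall x : M, r *: x = 0].

Definition nonzero_module (R : comNzRingType) (M : lmodType R) : Prop :=
  exists x : M, x != 0.

Section Submodules.
Variables (R : comNzRingType) (M : lmodType R).

Record submodule := Submodule {
  submodule_set :> set M;
  submoduleP : submod_closed (mem submodule_set) }.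

Variable N : submodule.

Definition submodule_mem : {pred M} := fun x => x \in submodule_set N.

HB.instance Definition _ :=
  GRing.isSubmodClosed.Build R M submodule_mem (submoduleP N).

Record submodule_type :=
  SubmoduleType { submodule_val :> M; _ : submodule_val \in submodule_mem }.

HB.instance Definition _ := [isSub for submodule_val].
HB.instance Definition _ := [Choice of submodule_type by <:].
HB.instance Definition _ :=
  [SubChoice_isSubLmodule of submodule_type by <:].

Definition quotient_module := Quotient.quot (submodule_mem : submodClosed M).

HB.instance Definition _ := GRing.Zmodule.on quotient_module.

Local Open Scope quotient_scope.

Definition quotient_scale (r : R) (x : quotient_module) : quotient_module :=
  \pi_quotient_module (r *: repr x).

Lemma quotient_scaleE r (x : M) :
  quotient_scale r (\pi_quotient_module x) = \pi_quotient_module (r *: x).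
Proof.
apply/eqP; rewrite -Quotient.idealrBE -scalerBr rpredZ //.
by rewrite Quotient.idealrBE reprK.
Qed.

Lemma quotient_piD (x y : M) : \pi_quotient_module (x + y) =
  \pi_quotient_module x + \pi_quotient_module y :> quotient_module.
Proof. exact: Quotient.pi_add. Qed.

Lemma quotient_piP (x : quotient_module) :
  exists y, x = \pi_quotient_module y.
Proof. by exists (repr x); rewrite reprK. Qed.

Lemma quotient_scaleA a b x :
  quotient_scale a (quotient_scale b x) = quotient_scale (a * b) x.
Proof. by have [y ->] := quotient_piP x; rewrite !quotient_scaleE scalerA. Qed.

Lemma quotient_scale1 : left_id 1 quotient_scale.
Proof.
by move=> x; have [y ->] := quotient_piP x; rewrite quotient_scaleE scale1r.
Qed.

Lemma quotient_scaleDr : right_distributive quotient_scale +%R.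
Proof.
move=> a x y; have [x' ->] := quotient_piP x; have [y' ->] := quotient_piP y.
by rewrite -quotient_piD !quotient_scaleE scalerDr quotient_piD.
Qed.

Lemma quotient_scaleDl x : {morph quotient_scale^~ x : a b / a + b}.
Proof.
move=> a b /=; have [y ->] := quotient_piP x.
by rewrite !quotient_scaleE scalerDl quotient_piD.
Qed.

HB.instance Definition _ := GRing.Zmodule_isLmodule.Build R quotient_module
  quotient_scaleA quotient_scale1 quotient_scaleDr quotient_scaleDl.

End Submodules.

Section LocalCohomology.
Variable R : comNzRingType.

Section Kernel.
Variables (M M' : lmodType R) (f : {linear M -> M'}).

Lemma kernel_closed : submod_closed (mem [set x : M | f x = 0]).
Proof.
split=> [|a x y]; rewrite !inE /= ?raddf0 // => fx fy.
by rewrite linearP fx fy scaler0 addr0.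
Qed.

Definition kernel : submodule M := Submodule kernel_closed.

Lemma image_closed : submod_closed (mem (range f)).
Proof.
split=> [|a _ _ /set_mem[x _ <-] /set_mem[y _ <-]]; apply/mem_set.
  by exists 0 => //; rewrite raddf0.
by exists (a *: x + y) => //; rewrite linearP.
Qed.

Definition image : submodule M' := Submodule image_closed.
End Kernel.

Section Subquotient.
Variables (M : lmodType R) (Z B : submodule M).

Lemma restrict_closed :
  submod_closed (mem [set x : submodule_type Z | (B : set M) (val x)]).
Proof.
have [B0 BP] := submoduleP B.
split=> [|a x y /set_mem Bx /set_mem By]; apply/mem_set/set_mem; first exact: B0.
by apply: BP; apply/mem_set.
Qed.

(* Z / (Z :&: B), that is Z / B when B is contained in Z. *)
Definition subquotient : lmodType R :=
  quotient_module (Submodule restrict_closed).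
End Subquotient.

Section Torsion.
Variable a : set R.

Lemma ideal_gen_ideal (A : set R) : is_ideal (ideal_gen A).
Proof.
split=> [|r x y /set_mem Ax /set_mem Ay]; apply/mem_set => J [Jid AJ].
  by case: Jid => /set_mem.
have [_ JP] := Jid.
by apply/set_mem; apply: JP; apply/mem_set; [apply: Ax | apply: Ay].
Qed.

Lemma ideal_pow_ideal n : is_ideal (ideal_pow a n).
Proof.
case: n => [|n]; last exact: ideal_gen_ideal.
by split=> [|r x y _ _]; apply/mem_set.
Qed.

Lemma ideal_powS n : ideal_pow a n.+1 `<=` ideal_pow a n.
Proof.
have [_ Pn] := ideal_pow_ideal n; have [/set_mem P0 _] := ideal_pow_ideal n.
move=> r; apply; split; first exact: ideal_pow_ideal.
move=> _ [x _] [y /mem_set ny <-]; apply/set_mem.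
by rewrite -[x * y]addr0; apply: Pn => //; apply/mem_set.
Qed.

Lemma ideal_pow_le n k : (n <= k)%N -> ideal_pow a k `<=` ideal_pow a n.
Proof.
move=> /subnK <-; elim: (k - n)%N => [|j IH]; rewrite ?add0n // addSn.
exact: subset_trans (@ideal_powS _) IH.
Qed.

Definition torsion_set (M : lmodType R) : set M :=
  [set x | exists n, forall r, ideal_pow a n r -> r *: x = 0].
Arguments torsion_set M : clear implicits.

Lemma torsion_closed (M : lmodType R) : submod_closed (mem (torsion_set M)).
Proof.
split=> [|r x y /set_mem[i xi] /set_mem[j yj]]; apply/mem_set.
  by exists 0%N => r _; rewrite scaler0.
exists (maxn i j) => t tij.
rewrite scalerDr scalerA mulrC -scalerA xi ?yj ?scaler0 ?addr0 //.
  exact: ideal_pow_le (leq_maxr i j) _ tij.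
exact: ideal_pow_le (leq_maxl i j) _ tij.
Qed.

(* Gamma_a(M) = \bigcup_n (0 :_M a^n). *)
Definition torsion (M : lmodType R) : lmodType R :=
  submodule_type (Submodule (torsion_closed M)).

Section TorsionMap.
Variables (M M' : lmodType R) (f : {linear M -> M'}).

Lemma torsion_map_subproof (x : torsion M) :
  f (val x) \in submodule_mem (Submodule (torsion_closed M')).
Proof.
have /set_mem[n xn] := valP x; apply/mem_set; exists n => r /xn xr0.
by rewrite -linearZ xr0 raddf0.
Qed.

Definition torsion_map (x : torsion M) : torsion M' :=
  SubmoduleType (torsion_map_subproof x).

Lemma torsion_map_linear : linear torsion_map.
Proof. by move=> r x y; apply: val_inj; rewrite /= !linearP. Qed.

HB.instance Definition _ :=
  GRing.isLinear.Build R (torsion M) (torsion M') _ torsion_map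
    torsion_map_linear.
End TorsionMap.
End Torsion.
Arguments torsion_map a {M M'} f x.

Definition injective_module (E : lmodType R) : Prop :=
  forall (M N : lmodType R) (f : {linear M -> N}) (g : {linear M -> E}),
    injective f -> exists h : {linear N -> E}, forall x, h (f x) = g x.

Record injective_resolution (M : lmodType R) := InjectiveResolution {
  res_module : nat -> lmodType R;
  res_diff : forall i, {linear res_module i -> res_module i.+1};
  res_aug : {linear M -> res_module 0%N};
  res_injective : forall i, injective_module (res_module i);
  res_aug_inj : injective res_aug;
  res_exact0 : range res_aug = [set x | res_diff 0%N x = 0];
  res_exact : forall i, range (res_diff i) = [set x | res_diff i.+1 x = 0] }.

Lemma zero_closed (M : lmodType R) : submod_closed (mem [set (0 : M)]).
Proof.
split=> [|r _ _ /set_mem-> /set_mem->]; apply/mem_set => //=.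
by rewrite scaler0 addr0.
Qed.

Definition cohomology (C : nat -> lmodType R)
    (d : forall i, {linear C i -> C i.+1}) (i : nat) : lmodType R :=
  match i with
  | 0%N => subquotient (kernel (d 0%N)) (Submodule (zero_closed (C 0%N)))
  | j.+1 => subquotient (kernel (d j.+1)) (image (d j))
  end.

(* H^i_a(M), the i-th right derived functor of Gamma_a at M.  Being a derived
   functor, it depends on the injective resolution E of M up to isomorphism
   only; in particular neither its annihilator nor its vanishing depends on E. *)
Definition local_cohomology (a : set R) (M : lmodType R)
    (E : injective_resolution M) (i : nat) : lmodType R :=
  cohomology (C := fun j => torsion a (res_module E j))
    (fun j => torsion_map a (res_diff E j)) i.

Definition cd_is (a : set R) (M : lmodType R) (E : injective_resolution M)
    (c : nat) : Prop :=
  sup_is [set i | nonzero_module (local_cohomology a E i)] c.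

End LocalCohomology.

(* Main.v *)
(* Local cohomology is computed by Cech complexes, built as iterated cones over
   localizations; dimension shifting along the given injective resolution
   identifies the annihilators.  Let c be the annihilator of H = H^d_a(R).
   Since H^i_a vanishes above the dimension, H^d_a is right exact, and c is the
   largest ideal I for which H^d_a(I) -> H^d_a(R) is zero.  By the same
   vanishing R/c has no nonzero submodule of dimension < d, so the radical of c
   is an intersection of minimal, hence associated, primes of R, and is
   therefore the annihilator of its annihilator.  It contains b because
   multiplication by an element of b factors through an a-torsion module.

   For (ii) the point is that H^d_a(N) -> H^d_a(M) is nonzero when N is a
   d-dimensional submodule of a module M on which a and the maximal ideal have
   the same support.  By induction on d: choose x in a, regular on a suitable
   quotient of M and on its quotient by the saturation W of a copy of R/p.  If
   the map vanished in degree d, the image of H^{d-1}(W/x^t W) in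
   H^{d-1}(M/x^t M) would come from the Artinian module H^{d-1}(M), hence be
   killed by a power of x independent of t, against the induction hypothesis. *)
Require Import Defs.
From HB Require Import structures.
From mathcomp Require Import all_boot all_order all_algebra.
From mathcomp Require Import ring_quotient.
From mathcomp Require Import boolp classical_sets functions.
Set Implicit Arguments.
Unset Strict Implicit.
Unset Printing Implicit Defensive.
Import GRing.Theory.
Local Open Scope classical_set_scope.
Local Open Scope ring_scope.

(** The obstacle is that local cohomology comes from one arbitrary injective resolution of R, while
    the argument needs long exact sequences for many modules. The Cech complex is an exact functor
    of the module, so these sequences follow from the snake lemma alone. No isomorphism with the
    derived functor is built: H^d_a(R) matters only through its annihilator, and that survives
    dimension shifting. In (ii) the nonvanishing statement is applied to a cyclic submodule R v of
    R/b; a and m have the same support on R/b because a + b is m-primary. It has to concern the map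
    induced by an inclusion, since H^d(R v) being nonzero would contradict nothing: if r kills
    H^d(R) but is outside b, a multiple of r defines a map from R onto R v, and only its composite
    into R/b is multiplication by that multiple followed by the projection, hence zero on H^d. *)

(** * Submodules, quotients and short exact sequences *)

Section Modules.
Variable R : comNzRingType.
Implicit Types M N A B C : lmodType R.

Definition lin M N (f : M -> N) (fP : linear f) : {linear M -> N} :=
  HB.pack f (GRing.isLinear.Build R M N _ f fP).

Definition submod M (S : set M) : Prop :=
  S 0 /\ forall r x y, S x -> S y -> S (r *: x + y).

Lemma submodP M (S : set M) : submod_closed (mem S) <-> submod S.
Proof.
split=> -[S0 SP]; split; rewrite ?inE // in S0 *.
  by move=> r x y Sx Sy; apply/set_mem/SP; rewrite inE.
by move=> r x y /set_mem Sx /set_mem Sy; apply/mem_set/SP.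
Qed.

Section Submod.
Variables (M : lmodType R) (S : set M).
Hypothesis SP : submod S.
Lemma submod0 : S 0. Proof. by case: SP. Qed.
Lemma submodD x y : S x -> S y -> S (x + y).
Proof. by move=> Sx Sy; rewrite -[x]scale1r; apply: SP.2. Qed.
Lemma submodZ r x : S x -> S (r *: x).
Proof. by move=> Sx; rewrite -[_ *: _]addr0; apply: SP.2 => //; apply: SP.1. Qed.
Lemma submodB x y : S x -> S y -> S (x - y).
Proof. by move=> Sx Sy; rewrite addrC -scaleN1r; apply: SP.2. Qed.
End Submod.

Lemma submod_kernel M N (f : {linear M -> N}) : submod [set x | f x = 0].
Proof.
by split=> [|r x y /= fx fy]; rewrite /= ?linear0 // linearP fx fy scaler0 addr0.
Qed.

Lemma submod_image M N (f : {linear M -> N}) S : submod S -> submod (f @` S).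
Proof.
move=> SP; split=> [|r _ _ [x Sx <-] [y Sy <-]].
  by exists 0; [apply: submod0|rewrite linear0].
by exists (r *: x + y); [apply: SP.2|rewrite linearP].
Qed.

Lemma submod_preimage M N (f : {linear M -> N}) S :
  submod S -> submod (f @^-1` S).
Proof.
move=> SP; split=> [|r x y Sx Sy]; rewrite /preimage/= ?linear0;
  first exact: submod0.
by rewrite linearP; apply: SP.2.
Qed.

Lemma submod_set0 M : submod [set (0 : M)].
Proof. by split=> //= r x y -> ->; rewrite scaler0 addr0. Qed.

Lemma submod_setT M : submod [set: M]. Proof. by []. Qed.

Definition sub_of M (S : set M) (SP : submod S) : submodule M :=
  Submodule ((submodP S).2 SP).

Lemma quotient_pi_linear M (N : submodule M) :
  linear (fun x : M => (\pi_(quotient_module N) x)%qT : quotient_module N).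
Proof. by move=> r x y; rewrite (quotient_piD N) -(quotient_scaleE N). Qed.

Lemma quotient_pi_eq0 M (N : submodule M) (x : M) :
  (\pi_(quotient_module N) x)%qT = 0 :> quotient_module N <-> (N : set M) x.
Proof.
have -> : (0 : quotient_module N) = lin (quotient_pi_linear N) 0.
  by rewrite linear0.
split=> [/eqP|Nx]; last first.
  by apply/eqP; rewrite -Quotient.idealrBE subr0; apply/mem_set.
by rewrite -Quotient.idealrBE subr0 => /set_mem.
Qed.

Section SealedSubquotients.
Variables (M : lmodType R) (S : set M) (SP : submod S).

Lemma submodule_val_linear :
  linear (fun x : submodule_type (sub_of SP) => submodule_val x).
Proof. by []. Qed.

(* Sealed, lest unification unfold submodules and quotients down to their
   underlying modules. *)
Lemma subm_sig : {N : lmodType R &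
  {f : {linear N -> M} | injective f & forall x, S x <-> exists y, f y = x}}.
Proof.
exists (submodule_type (sub_of SP)), (lin submodule_val_linear) => [|x].
  exact: val_inj.
split=> [/mem_set Sx|[[y Sy] <-]]; last exact/set_mem.
by exists (SubmoduleType (Sx : x \in submodule_mem (sub_of SP))).
Qed.

Lemma quom_sig : {N : lmodType R & {f : {linear M -> N} |
  forall x, f x = 0 <-> S x & forall y, exists x, f x = y}}.
Proof.
exists (quotient_module (sub_of SP)), (lin (quotient_pi_linear (sub_of SP))) =>
  [x|y].
  exact: quotient_pi_eq0.
by have [x ->] := quotient_piP y; exists x.
Qed.

End SealedSubquotients.

Section Subquotients.
Variables (M : lmodType R) (S : set M) (SP : submod S).

Definition subm : lmodType R := projT1 (subm_sig SP).
Definition sincl : {linear subm -> M} := s2val (projT2 (subm_sig SP)).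

Lemma sincl_inj : injective sincl.
Proof. exact: s2valP (projT2 (subm_sig SP)). Qed.

Lemma sinclP x : S (sincl x).
Proof. by apply/(s2valP' (projT2 (subm_sig SP))); exists x. Qed.

Lemma sincl_surj x : S x -> exists y, sincl y = x.
Proof. by move/(s2valP' (projT2 (subm_sig SP))). Qed.

Definition quom : lmodType R := projT1 (quom_sig SP).
Definition quo : {linear M -> quom} := s2val (projT2 (quom_sig SP)).

Lemma quo_surj x : exists y, quo y = x.
Proof. exact: s2valP' (projT2 (quom_sig SP)) x. Qed.

Lemma quo_eq0 x : quo x = 0 <-> S x.
Proof. exact: s2valP (projT2 (quom_sig SP)) x. Qed.

End Subquotients.

(** Most maps below are known only through choices of representatives. A relation closed under
    linear combinations is single-valued as soon as it is so at 0, so independence of the choices is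
    checked at 0 only. *)
Lemma linear_of_rel M N (rel : M -> N -> Prop) :
  (forall x, exists y, rel x y) ->
  (forall r x x' y y', rel x y -> rel x' y' -> rel (r *: x + x') (r *: y + y')) ->
  (forall y, rel 0 y -> y = 0) ->
  exists f : {linear M -> N}, forall x, rel x (f x).
Proof.
move=> tot lin0 unq.
have [f fP] := choice tot.
have uniq x y y' : rel x y -> rel x y' -> y = y'.
  move=> xy xy'; apply/eqP; rewrite -subr_eq0; apply/eqP; apply: unq.
  have := lin0 (-1) _ _ _ _ xy' xy.
  by rewrite scaleN1r addNr scaleN1r addrC.
have fL : linear f.
  by move=> r x y; apply: uniq (fP _) _; apply: lin0.
by exists (lin fL).
Qed.

Definition ses A B C (f : {linear A -> B}) (g : {linear B -> C}) : Prop :=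
  [/\ injective f, (forall b, g b = 0 <-> exists a, f a = b)
    & forall c, exists b, g b = c].

Lemma ses_quo M (S : set M) (SP : submod S) : ses (sincl SP) (quo SP).
Proof.
split; [exact: sincl_inj| move=> x | exact: quo_surj].
rewrite quo_eq0; split=> [/(sincl_surj SP)//|[y <-]]; exact: sinclP.
Qed.

Lemma inj_lin0 M N (f : {linear M -> N}) : (forall x, f x = 0 -> x = 0) ->
  injective f.
Proof.
move=> f0 x y /eqP; rewrite -subr_eq0 -linearB => /eqP/f0/eqP.
by rewrite subr_eq0 => /eqP.
Qed.

Lemma ses_image M N (f : {linear M -> N}) :
  injective f -> ses f (quo (submod_image f (@submod_setT M))).
Proof.
move=> finj; split => // [x|]; last exact: quo_surj.
by rewrite quo_eq0; split=> [[y _ <-]|[y <-]]; exists y.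
Qed.

Definition trivial_mod M := forall x : M, x = 0.

Definition annv M (v : M) : set R := [set r | r *: v = 0].

Lemma scale_linear M r : linear (fun x : M => r *: x).
Proof. by move=> s x y; rewrite scalerDr !scalerA mulrC. Qed.

Definition smul M r : {linear M -> M} := lin (@scale_linear M r).

End Modules.

(** * Factorization of linear maps and the maximal condition *)

Section Factor.
Variable R : comNzRingType.
Implicit Types M N A B C : lmodType R.

Lemma corestr_ex M N (S : set N) (SP : submod S) (f : {linear M -> N}) :
  (forall x, S (f x)) ->
  exists g : {linear M -> subm SP}, forall x, sincl SP (g x) = f x.
Proof.
move=> fS.
pose rel x (y : subm SP) := sincl SP y = f x.
have [||y|g gP] := @linear_of_rel _ _ _ rel; last by exists g.
- by move=> x; apply: sincl_surj.
- by move=> r x x' y y' xy xy'; rewrite /rel !linearP xy xy'.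
- by rewrite /rel linear0 => y0; apply: (@sincl_inj _ _ _ SP); rewrite y0 linear0.
Qed.

Lemma quo_lift_ex M N (S : set M) (SP : submod S) (f : {linear M -> N}) :
  (forall x, S x -> f x = 0) ->
  exists g : {linear quom SP -> N}, forall x, g (quo SP x) = f x.
Proof.
move=> fS.
pose rel (y : quom SP) z := exists2 x, quo SP x = y & f x = z.
have [||y|g gP] := @linear_of_rel _ _ _ rel.
- by move=> y; have [x xy] := quo_surj y; exists (f x), x.
- move=> r _ _ _ _ [x <- <-] [y <- <-].
  by exists (r *: x + y); rewrite linearP.
- by move=> [x /quo_eq0 Sx <-]; apply: fS.
exists g => x; have [y yx <-] := gP (quo SP x).
apply/eqP; rewrite -subr_eq0 -linearB; apply/eqP/fS/(quo_eq0 SP).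
by rewrite linearB yx subrr.
Qed.

(** Devissage and the enlargement of submodules in top degree both replace S by the preimage of a
    submodule of the quotient; this sequence controls that step. *)
Lemma ses_preimage M (S : set M) (SP : submod S) (K : set (quom SP))
    (KP : submod K) (LP := submod_preimage (quo SP) KP) :
  exists (f : {linear subm SP -> subm LP}) (g : {linear subm LP -> subm KP}),
    [/\ ses f g, forall x, sincl LP (f x) = sincl SP x
      & forall x, sincl KP (g x) = quo SP (sincl LP x)].
Proof.
have SL x : (quo SP @^-1` K) (sincl SP x).
  rewrite /preimage/= (_ : quo SP _ = 0); first exact: submod0.
  by apply/quo_eq0; exact: (@sinclP _ _ _ SP x).
have [f fP] := corestr_ex LP SL.
have LK x : K ((quo SP \o sincl LP) x) by exact: (@sinclP _ _ _ LP x).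
have [g gP] := corestr_ex KP LK.
exists f, g; split=> //; split.
- by move=> x y xy; apply: (sincl_inj (SP := SP)); rewrite -!fP xy.
- move=> x; split=> [gx|[y <-]].
    have /quo_eq0 /(sincl_surj SP)[y yx] : quo SP (sincl LP x) = 0.
      by have := gP x; rewrite gx linear0.
    by exists y; apply: (sincl_inj (SP := LP)); rewrite fP.
  apply: (sincl_inj (SP := KP)); rewrite gP linear0 /= fP.
  by apply/quo_eq0; exact: (@sinclP _ _ _ SP y).
- move=> w; have [x xw] := quo_surj (SP := SP) (sincl KP w).
  have [y yx] : exists y, sincl LP y = x.
    by apply: sincl_surj; rewrite /preimage/= xw; exact: (@sinclP _ _ _ KP w).
  by exists y; apply: (sincl_inj (SP := KP)); rewrite gP /= yx.
Qed.

Lemma eq_submod M (S T : set M) : S `<=` T -> T `<=` S -> T = S.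
Proof. by move=> ST TS; rewrite eqEsubset. Qed.

(** The maximal condition rather than finite generation: it passes to submodules and quotients by
    transporting the family, and most later uses ask for a maximal member. *)
Definition noeth M : Prop := forall P : set (set M),
  (exists S, P S) -> (forall S, P S -> submod S) ->
  exists S, P S /\ forall T, P T -> S `<=` T -> T = S.

Lemma noeth_inj M N (f : {linear M -> N}) : injective f -> noeth N -> noeth M.
Proof.
move=> finj NN P [S0 PS0] PP.
have [|_ [S PS <-]|_ [[S PS <-] Smax]] := NN [set f @` S | S in P].
- by exists (f @` S0), S0.
- exact/submod_image/PP.
exists S; split=> // T PT ST.
have /Smax E : [set f @` S | S in P] (f @` T) by exists T.
have {}/E E : f @` S `<=` f @` T by exact: image_subset.
apply: eq_submod => // x Tx.
have : (f @` T) (f x) by exists x.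
by rewrite E => -[y Sy /finj <-].
Qed.

Lemma noeth_surj M N (f : {linear M -> N}) :
  (forall y, exists x, f x = y) -> noeth M -> noeth N.
Proof.
move=> fs NM P [S0 PS0] PP.
have [|_ [S PS <-]|_ [[S PS <-] Smax]] := NM [set f @^-1` S | S in P].
- by exists (f @^-1` S0), S0.
- exact/submod_preimage/PP.
exists S; split=> // T PT ST.
have /Smax E : [set f @^-1` S | S in P] (f @^-1` T) by exists T.
have {}/E E : f @^-1` S `<=` f @^-1` T by move=> x; apply: ST.
apply: eq_submod => // y.
have [x <-] := fs y => Tx.
by have : (f @^-1` T) x by []; rewrite E.
Qed.

Lemma noeth_chain M (S : nat -> set M) : noeth M -> (forall n, submod (S n)) ->
  (forall n, S n `<=` S n.+1) ->
  exists n, forall k, (n <= k)%N -> S k = S n.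
Proof.
move=> NM SP Sle.
have le n k : (n <= k)%N -> S n `<=` S k.
  move/subnK <-; elim: (k - n)%N => [|j IH]; first by rewrite add0n.
  by rewrite addSn; apply: subset_trans IH _.
have [||_ [[n _ <-] nmax]] := NM (range S); first by exists (S 0%N), 0%N.
  by move=> _ [n _ <-].
exists n => k nk; apply: nmax; [by exists k|exact: le].
Qed.

Lemma noeth_ring : noetherian R -> noeth (R^o : lmodType R).
Proof.
move=> NR P [S0 PS0] PP.
(* [Zorn_bigcup] also asks for the union of the empty chain, which is empty. *)
pose P' : set (set R^o) := P `|` [set set0].
have [|A [P'A Amax]] := @Zorn_bigcup _ P'.
  move=> F FP' Ftot.
  have [[S1 [FS1 PS1]]|F0] := pselect (exists S, F S /\ P S); last first.
    right; rewrite /= -subset0 => x [X FX Xx].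
    case: (FP' _ FX) => [PX|X0]; last by move: Xx; rewrite X0.
    by case: F0; exists X.
  set U := \bigcup_(X in F) X.
  have UX X : F X -> X `<=` U by move=> FX x Xx; exists X.
  have Uid : submod U.
    split=> [|r x y [X FX Xx] [Y FY Yy]].
      by exists S1 => //; exact: submod0 (PP _ PS1).
    have XP : submod X by case: (FP' _ FX) => [/PP//|X0]; move: Xx; rewrite X0.
    have YP : submod Y by case: (FP' _ FY) => [/PP//|Y0]; move: Yy; rewrite Y0.
    case: (Ftot _ _ FX FY) => le.
      by exists Y => //; apply: YP.2 => //; apply: le.
    by exists X => //; apply: XP.2 => //; apply: le.
  (* The union is finitely generated, so a member of the chain that contains all the generators is
     the whole union. *)
  have [s sU] := NR _ ((submodP _).2 Uid).
  have [X [FX [PX sX]]] : exists X, F X /\ P X /\ [set` s] `<=` X.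
    have : [set` s] `<=` U by rewrite sU; apply: sub_gen_smallest.
    elim: s {sU} => [_|x s IH sU]; first by exists S1; split.
    have [y ys|X [FX [PX sX]]] := IH.
      by apply: sU; rewrite /= inE ys orbT.
    have [Y FY Yx] : U x by apply: sU; rewrite /= inE eqxx.
    have PY : P Y by case: (FP' _ FY) => // Y0; move: Yx; rewrite Y0.
    case: (Ftot _ _ FX FY) => le.
      exists Y; do 2!split=> //; move=> z; rewrite /= inE => /orP[/eqP->//|zs].
      exact/le/sX.
    exists X; do 2!split=> //; move=> z; rewrite /= inE => /orP[/eqP->|zs].
      exact: le.
    exact: sX.
  left; suff -> : U = X by [].
  apply: eq_submod; first exact: UX.
  rewrite sU => z; apply; split=> //; apply/(submodP (X : set R^o)); exact: PP.
have PA : P A.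
    case: P'A => // A0; case: (Amax S0); last by left.
    rewrite A0; split; first exact: sub0set.
    by move/(_ 0); apply; exact: submod0 (PP _ PS0).
  exists A; split=> // T PT AT; apply: eq_submod => //.
  apply: contrapT => TA; exact: (Amax T (conj AT TA) (or_introl PT)).
Qed.

End Factor.

(** * Prime ideals, dimension and associated primes *)

Section Primes.
Variable R : comNzRingType.
Implicit Types (M N A B C : lmodType R) (I J p q : set R).

Definition ideal I : Prop := submod (I : set (R^o : lmodType R)).

Lemma idealM I r x : ideal I -> I x -> I (r * x).
Proof. by move=> IP Ix; apply: (submodZ IP). Qed.

Definition primei p : Prop :=
  [/\ ideal p, ~ p 1 & forall x y, p (x * y) -> p x \/ p y].

Lemma is_prime_idealP p : is_prime_ideal p <-> primei p.
Proof.
split.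
  move=> -[[/set_mem p0 /negP p1 pL] pM]; split.
  - by split=> // r x y /mem_set px /mem_set py; apply/set_mem/pL.
  - by move=> ?; apply/p1/mem_set.
  - move=> x y /mem_set /pM /orP[] /set_mem; by [left|right].
move=> [[p0 pL] p1 pM]; split; first split.
- exact/mem_set.
- by apply/negP => /set_mem.
- by move=> r x y /set_mem px /set_mem py; apply/mem_set/pL.
- by move=> x y /set_mem/pM[] ?; apply/orP; [left|right]; apply/mem_set.
Qed.

Lemma prime_exp p x n : primei p -> p (x ^+ n) -> p x.
Proof.
move=> [_ p1 pM]; elim: n => [|n IH]; first by rewrite expr0 => /p1.
by rewrite exprS => /pM[].
Qed.

Lemma ideal_annv M (v : M) : ideal (annv v).
Proof.
split=> [|r x y /= xv yv]; first exact: scale0r.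
by rewrite /annv/= scalerDl -scalerA xv yv scaler0 addr0.
Qed.

Lemma annvZ M x (v : M) : annv v `<=` annv (x *: v).
Proof. by move=> r /= rv; rewrite /annv/= scalerA mulrC -scalerA rv scaler0. Qed.

Lemma ideal_ann M : ideal (annihilator M).
Proof.
split=> [v|r x y xM yM v]; first exact: scale0r.
by rewrite scalerDl -scalerA xM yM scaler0 addr0.
Qed.

(** The chain starts at its smallest prime p, so this bounds dim R/p from below by n. *)
Fixpoint pchain n p : Prop :=
  primei p /\ (if n is n'.+1 then exists q, p `<` q /\ pchain n' q else True).

Lemma pchain_prime n p : pchain n p -> primei p.
Proof. by case: n => [|n] []. Qed.

Lemma pchain_sub n p q : pchain n p -> primei q -> q `<=` p -> pchain n q.
Proof.
case: n => [|n] /= [pp pn] qq qp; split=> //.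
have [p' [[pp' p'p] p'n]] := pn; exists p'; split=> //; split.
  exact: subset_trans pp'.
by move=> p'q; apply/p'p/(subset_trans p'q).
Qed.

(* dim (R / I) < n *)
Definition dim_lt n I : Prop := forall p, pchain n p -> ~ I `<=` p.

Lemma dim_lt_sub n I J : I `<=` J -> dim_lt n I -> dim_lt n J.
Proof. by move=> IJ dI p /dI Ip Jp; apply/Ip/(subset_trans IJ). Qed.

Lemma prime_chainP n :
  prime_chain R n <-> exists p, pchain n p.
Proof.
split=> [[p [pP plt]]|].
  suff H k (hk : (k <= n)%N) i : (i = n - k :> nat)%N -> forall hi : (i < n.+1)%N,
      pchain k (p (Ordinal hi)).
    by exists (p ord0); have := H n (leqnn _) 0%N (esym (subnn n)) (ltn0Sn n);
      congr (pchain n (p _)); apply: val_inj.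
  elim: k i hk => [|k IH] i hk ik hi /=; first by split=> //; apply/is_prime_idealP.
  split; first exact/is_prime_idealP.
  have hi1 : (i.+1 < n.+1)%N by rewrite ltnS ik -subSn // subSS leq_subr.
  exists (p (Ordinal hi1)); split; first exact: plt.
  by apply: IH (ltnW hk) _ _; rewrite ik -subSn // subSS.
move=> [p pn].
suff [f [f0 [fP flt]]] : exists f : nat -> set R, f 0%N = p /\
    (forall i, (i <= n)%N -> primei (f i)) /\
    (forall i j, (i < j <= n)%N -> f i `<` f j).
  exists (fun i => f i); split=> [i|i j ij]; first by apply/is_prime_idealP/fP;
    rewrite -ltnS.
  by apply: flt; rewrite ij -ltnS ltn_ord.
elim: n p pn => [|n IH] p [pp pn].
  exists (fun=> p); do 2!split=> //.
  by move=> i j /andP[]; case: j.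
have [q [pq qn]] := pn; have [f [f0 [fP flt]]] := IH _ qn.
exists (fun i => if i is i'.+1 then f i' else p); split=> //; split=> [[|i]//|].
  exact: fP.
move=> [|i] [|j] //; last exact: flt.
move=> jn; case: j jn => [|j] jn; first by rewrite f0.
have fj : f 0%N `<` f j.+1 by apply: flt.
rewrite f0 in fj; case: pq => pq qp; case: fj => qj jq; split.
  exact: subset_trans qj.
by move=> jp; apply/qp/(subset_trans qj).
Qed.

Section Noetherian.
Hypothesis NR : noeth (R^o : lmodType R).

Lemma ex_prime_disjoint (U : set R) I : ideal I -> U 1 ->
  (forall x y, U x -> U y -> U (x * y)) -> (forall x, U x -> ~ I x) ->
  exists q, [/\ primei q, I `<=` q & forall x, U x -> ~ q x].
Proof.
move=> II U1 UM UI.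
pose P J := [/\ ideal J, I `<=` J & forall x, U x -> ~ J x].
have [||q [[qI Iq Uq] qmax]] := NR (P := P); first by exists I; split.
  by move=> S [].
exists q; split=> //; split=> //; first exact: Uq.
move=> x y qxy; apply: contrapT => /not_orP[qx qy].
(* For z outside q, the ideal q + (z) meets U; doing this for x and for y puts a product of two
   elements of U into q. *)
have big z : ~ q z -> exists2 u, U u & exists r t, q t /\ u = r * z + t.
  move=> qz; apply: contrapT => H; apply: qz.
  pose T : set R := [set w | exists r t, q t /\ w = r * z + t].
  suff <- : T = q.
    by exists 1, 0; split; [exact: submod0 qI|rewrite mul1r addr0].
  have qT : q `<=` T by move=> t qt; exists 0, t; rewrite mul0r add0r.
  apply: qmax => //; split.
  - split=> [|r _ _ [a [t [qt ->]]] [b [s [qs ->]]]]; first exact/qT/(submod0 qI).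
    exists (r * a + b), (r * t + s); split; first exact: qI.2.
    by rewrite /GRing.scale/= mulrDr mulrDl addrACA mulrA.
  - exact: subset_trans qT.
  - by move=> w Uw Tw; apply: H; exists w.
have [u Uu [r [t [qt ut]]]] := big _ qx; have [v Uv [s [w [qw vw]]]] := big _ qy.
apply: (Uq _ (UM _ _ Uu Uv)).
have -> : u * v = (r * s) * (x * y) + ((r * x) * w + v * t).
  rewrite ut mulrDl [X in _ + X]mulrC vw mulrDr -addrA; congr (_ + _).
  by rewrite -!mulrA; congr (_ * _); rewrite mulrCA.
apply: (submodD qI); first exact: idealM.
by apply: (submodD qI); apply: idealM.
Qed.

(** Below any prime p containing J there is a strictly smaller prime containing I: the products s
    x^k with s outside p avoid I since x is regular modulo I, and a prime avoiding them lies inside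
    p and misses x. *)
Lemma dim_lt_regular n I J x T : ideal I -> I `<=` J -> J (x ^+ T) ->
  (forall s, I (s * x) -> I s) -> dim_lt n.+1 I -> dim_lt n J.
Proof.
move=> II IJ JT Ireg dI p pn Jp.
have [pI p1 pM] := pchain_prime pn.
have Ireg' s k : I (s * x ^+ k) -> I s.
  by elim: k => [|k IH]; rewrite ?mulr1 // exprSr mulrA => /Ireg.
pose U : set R := [set w | exists2 s, ~ p s & exists k, w = s * x ^+ k].
have [||_ [s ps [k ->]] /Ireg' Is|q [qP Iq Uq]] := @ex_prime_disjoint U I II.
- by exists 1 => //; exists 0%N; rewrite mul1r.
- move=> _ _ [s ps [k ->]] [t pt [j ->]]; exists (s * t).
    by case/pM.
  by exists (k + j)%N; rewrite exprD mulrACA.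
- exact/ps/Jp/IJ.
apply: (dI q) => //; split=> //; exists p; split=> //; split.
  move=> s qs; apply: contrapT => ps; apply: (Uq s) => //.
  by exists s => //; exists 0%N; rewrite mulr1.
move=> pq; apply: (Uq x).
  by exists 1 => //; exists 1%N; rewrite mul1r.
apply: pq; apply: prime_exp; last exact: (Jp _ JT).
exact: pchain_prime pn.
Qed.

(** The usual argument with a maximal annihilator, restricted to annihilators inside p so that the
    prime obtained stays below p. If x (t v) is killed by some u outside p, then u (t v) replaces x
    (t v) in that argument. *)
Lemma ex_annv_prime M (v : M) p : primei p -> annv v `<=` p ->
  exists t, primei (annv (t *: v)) /\ annv (t *: v) `<=` p.
Proof.
move=> [pI p1 pM] vp.
pose P J := exists2 t, J = annv (t *: v) & J `<=` p.
have [||_ [[t -> tp] tmax]] := NR (P := P).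
- by exists (annv v); exists 1; rewrite ?scale1r.
- by move=> _ [t -> _]; apply: ideal_annv.
exists t; split=> //; split; first exact: ideal_annv.
  by move/tp.
move=> x y xyt; apply: contrapT => /not_orP[xt yt].
have [sub|] := pselect (annv (x *: (t *: v)) `<=` p).
  apply: yt; rewrite -(tmax (annv (x *: (t *: v)))).
  - by rewrite /annv/= scalerA mulrC.
  - by exists (x * t) => //; rewrite scalerA.
  - exact: annvZ.
move=> /existsNP[u /not_implyP[ux pu]].
apply: xt; rewrite -(tmax (annv (u *: (t *: v)))).
- by rewrite /annv/= scalerA mulrC -scalerA.
- exists (u * t); first by rewrite scalerA.
  move=> r ru; have /tp/pM[//|pu'] : annv (t *: v) (r * u); last by case: pu.
  by rewrite /annv/= -scalerA.
- exact: annvZ.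
Qed.

Lemma submod_span M (v : M) : submod [set r *: v | r in [set: R]].
Proof.
split=> [|r _ _ [s _ <-] [t _ <-]]; first by exists 0; rewrite ?scale0r.
by exists (r * s + t); rewrite // scalerDl scalerA.
Qed.

(** Otherwise each vector is killed by an element outside p. A maximal submodule T killed by a
    single such s is then everything, because T + R v is killed by s t when t kills v. *)
Lemma ex_annv_sub M p : noeth M -> primei p -> annihilator M `<=` p ->
  exists v : M, annv v `<=` p.
Proof.
move=> NM [pI p1 pM] Mp.
apply: contrapT => /forallNP H.
have kill (v : M) : exists2 s, s *: v = 0 & ~ p s.
  by have /existsNP[s /not_implyP[sv ps]] := H v; exists s.
pose P (T : set M) := submod T /\ exists2 s, ~ p s & forall u, T u -> s *: u = 0.
have [||T [[TP [s ps sT]] Tmax]] := NM P.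
- exists [set 0]; split; first exact: submod_set0.
  by exists 1 => // _ ->; rewrite scaler0.
- by move=> T [].
suff TT v : T v by apply/ps/Mp => v; apply: sT.
have [t tv pt] := kill v.
suff <- : [set u | exists2 r, T (u - r *: v) & True] = T.
  by exists 1 => //; rewrite scale1r subrr; apply: submod0.
apply: Tmax; last by move=> u Tu; exists 0 => //; rewrite scale0r subr0.
split.
  split=> [|r x y [a Ta _] [b Tb _]].
    by exists 0; rewrite // scale0r subr0; apply: submod0.
  exists (r * a + b) => //.
  have := TP.2 r _ _ Ta Tb; congr T.
  by rewrite scalerBr scalerDl opprD scalerA addrACA.
exists (s * t); first by case/pM.
move=> u [r /sT H1 _]; rewrite -(subrK (r *: v) u) scalerDr mulrC -scalerA.
rewrite H1 scaler0 add0r mulrC -scalerA [t *: _]scalerA mulrC -[(r * t) *: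
  v]scalerA tv.
by rewrite !scaler0.
Qed.

Section Devissage.
Variable m : set R.
Hypothesis mP : primei m.
Hypothesis mmax : forall I, ideal I -> ~ I 1 -> I `<=` m.

(** A submodule S maximal among those with property Q must be M: otherwise M/S contains a copy of
    some R/p, and its preimage is a larger submodule with Q. *)
Lemma devissage (Q : lmodType R -> Prop) M :
  (forall N, trivial_mod N -> Q N) ->
  (forall A B C (f : {linear A -> B}) (g : {linear B -> C}),
    ses f g -> Q A -> Q C -> Q B) ->
  noeth M ->
  (forall C (v : C), primei (annv v) -> annihilator M `<=` annv v ->
    (forall u, exists r, r *: v = u) -> noeth C -> Q C) -> Q M.
Proof.
move=> Q0 Qext NM Qcyc.
pose P (S : set M) := exists SP : submod S, Q (subm SP).
have [||S [[SP QS] Smax]] := NM P.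
- exists [set 0], (submod_set0 M); apply: Q0 => x.
  by apply: (sincl_inj (SP := submod_set0 M)); rewrite linear0 (sinclP x).
- by move=> T [].
have [ST|] := pselect (forall u, S u).
  apply: Qext (ses_quo SP) QS (Q0 _ _) => u.
  by have [x <-] := quo_surj u; apply/quo_eq0/ST.
move=> /existsNP[u Su].
have [|t [tP _]] := ex_annv_prime mP (v := quo SP u).
  apply: mmax; first exact: ideal_annv.
  by rewrite /annv/= scale1r => /quo_eq0.
set v := t *: quo SP u in tP.
have CP := submod_span v.
pose S' := quo SP @^-1` [set r *: v | r in [set: R]].
pose S'P : submod S' := submod_preimage (quo SP) CP.
have S't : S' (t *: u) by exists 1; rewrite // scale1r linearZ.
have St : ~ S (t *: u).
  move=> St; case: tP => _ + _; apply.
  by rewrite /annv/= scale1r /v -linearZ; apply/quo_eq0.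
have SS' : S `<=` S'.
  by move=> x Sx; exists 0; rewrite // scale0r; apply/esym/quo_eq0.
suff QS' : Q (subm S'P) by case: St; rewrite -(Smax S') //; exists S'P.
have [f [g [fg _ _]]] := ses_preimage CP.
have [v' v'E] := sincl_surj CP (ex_intro2 _ _ 1 I (scale1r v)).
apply: (Qext _ _ _ f g) => //; apply: (Qcyc _ v').
- suff -> : annv v' = annv v by [].
  apply/seteqP; split=> r rv.
    by rewrite /annv/= -v'E -linearZ rv linear0.
  by apply: (sincl_inj (SP := CP)); rewrite linearZ_LR v'E rv linear0.
- move=> r rM; apply: (sincl_inj (SP := CP)); rewrite linearZ_LR v'E linear0.
  by rewrite /v -linearZ_LR -linearZ_LR rM linear0.
- move=> w; have [r _ rw] := sinclP w; exists r.
  by apply: (sincl_inj (SP := CP)); rewrite linearZ_LR v'E.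
- by apply: noeth_inj (@sincl_inj _ _ _ CP) _;
  apply: noeth_surj (@quo_surj _ _ _ SP) NM.
Qed.

End Devissage.
End Noetherian.
End Primes.

(** * Localization at one element *)

Section Localization.
Variables (R : comNzRingType) (x : R).
Implicit Types M N A B C D : lmodType R.

(* The colimit of multiplication by x is modelled by the sequences satisfying
   u (n + 1) = x u n for large n, modulo those that vanish for large n. *)
Lemma loc_sig M : {L : lmodType R & {f : {linear M -> L} |
  [/\ forall u, f u = 0 <-> exists n, x ^+ n *: u = 0,
      forall l, exists n u, x ^+ n *: l = f u,
      forall l : L, x *: l = 0 -> l = 0 &
      forall l, exists l' : L, x *: l' = l]}}.
Proof.
pose T : lmodType R := nat -> M.
have addE (u v : T) n : (u + v) n = u n + v n by [].
have sclE r (u : T) n : (r *: u) n = r *: u n by [].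
have subE (u v : T) n : (u - v) n = u n - v n by [].
pose Z : set T := [set u | exists n0, forall n, (n0 <= n)%N -> u n.+1 = x *: u n].
pose B : set T := [set u | exists n0, forall n, (n0 <= n)%N -> u n = 0].
have ZP : submod Z.
  split=> [|r u v [i iu] [j jv]]; first by exists 0%N => n _; rewrite scaler0.
  exists (maxn i j) => n; rewrite geq_max => /andP[/iu un /jv vn].
  rewrite !addE !sclE un vn.
  by rewrite scalerDr !scalerA mulrC.
have BP : submod B.
  split=> [|r u v [i iu] [j jv]]; first by exists 0%N.
  exists (maxn i j) => n; rewrite geq_max => /andP[/iu un /jv vn].
  by rewrite addE sclE un vn scaler0 addr0.
have BZP := submod_preimage (sincl ZP) BP.
pose s (u : M) : T := fun n => x ^+ n *: u.
have sL : linear s.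
  move=> r u v; apply/funext => n.
  by rewrite addE sclE /s scalerDr !scalerA mulrC.
have Zs u : Z (lin sL u).
  by exists 0%N => n _; rewrite /= /s exprS scalerA.
have ZE u n0 : (forall n, (n0 <= n)%N -> u n.+1 = x *: u n) ->
    forall n, (n0 <= n)%N -> u n = x ^+ (n - n0) *: u n0 :> M.
  move=> uP n /subnK <-; rewrite addnK.
  elim: (n - n0)%N => [|k IH]; first by rewrite scale1r.
  by rewrite addSn uP ?leq_addl // IH scalerA exprS.
have [g gP] := cid (corestr_ex ZP Zs).
exists (quom BZP), (quo BZP \o g); split=> [u|l|l|l].
- rewrite /= quo_eq0 /preimage/= gP; split=> [[n0 n0P]|[n un]].
    by exists n0; apply: n0P.
  exists n => k /subnK <-; rewrite /= /s exprD -scalerA un scaler0 //.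
- have [z <-] := quo_surj l; have [n0 /ZE uE] := sinclP z.
  exists n0, (sincl ZP z n0); apply/eqP.
  rewrite -linearZ_LR -subr_eq0 -linearB; apply/eqP/quo_eq0; exists n0 => n nn0.
  rewrite linearB linearZ_LR gP subE sclE /=.
  apply/eqP; rewrite subr_eq0; apply/eqP; rewrite (uE n nn0) /s scalerA -exprD.
  by rewrite subnKC.
- have [z <-] := quo_surj l; have [n0 uE] := sinclP z.
  rewrite -linearZ_LR => /quo_eq0[n1 n1P]; apply/quo_eq0.
  exists (maxn n0 n1).+1 => -[//|n]; rewrite ltnS geq_max => /andP[h0 h1].
  rewrite uE //; have := n1P n h1.
  by rewrite linearZ_LR sclE.
- have [z <-] := quo_surj l; have [n0 uE] := sinclP z.
  have [z' z'E] : exists z', sincl ZP z' = (fun n => sincl ZP z n.-1) :> T.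
    apply: sincl_surj; exists n0.+1 => -[//|n]; rewrite ltnS => nn0.
    exact: uE.
  exists (quo BZP z'); apply/eqP.
  rewrite -linearZ_LR -subr_eq0 -linearB; apply/eqP/quo_eq0.
  exists n0.+1 => -[//|n]; rewrite ltnS => nn0.
  rewrite linearB linearZ_LR z'E subE sclE.
  by rewrite -uE // subrr.
Qed.

Definition loc M : lmodType R := projT1 (loc_sig M).
Definition to_loc M : {linear M -> loc M} := sval (projT2 (loc_sig M)).

Lemma to_loc_eq0 M (u : M) : to_loc M u = 0 <-> exists n, x ^+ n *: u = 0.
Proof. by case: (svalP (projT2 (loc_sig M))) => + _ _ _; exact. Qed.

Lemma loc_denom M (l : loc M) : exists n u, x ^+ n *: l = to_loc M u.
Proof. by case: (svalP (projT2 (loc_sig M))) => _ + _ _; exact. Qed.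

Lemma loc_scale_inj M n (l : loc M) : x ^+ n *: l = 0 -> l = 0.
Proof.
case: (svalP (projT2 (loc_sig M))) => _ _ xinj _.
elim: n => [|n IH]; first by rewrite scale1r.
by rewrite exprS -scalerA => /xinj.
Qed.

Lemma loc_scale_surj M n (l : loc M) : exists l' : loc M, x ^+ n *: l' = l.
Proof.
case: (svalP (projT2 (loc_sig M))) => _ _ _ xsurj.
elim: n l => [|n IH] l; first by exists l; rewrite scale1r.
have [k kl] := xsurj l; have [k' k'k] := IH k; exists k'.
by rewrite exprS -scalerA k'k.
Qed.

(** Fractions are never written down: an element and its image are matched after multiplication by a
    common power of x, and the relation is single-valued because x acts injectively on the
    localization. *)
Lemma loc_map_ex M N (f : {linear M -> N}) :
  exists g : {linear loc M -> loc N}, forall u, g (to_loc M u) = to_loc N (f u).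
Proof.
pose rel (l : loc M) (l' : loc N) := exists n u,
  x ^+ n *: l = to_loc M u /\ x ^+ n *: l' = to_loc N (f u).
have [||l'|g gP] := @linear_of_rel _ _ _ rel.
- move=> l; have [n [u lu]] := loc_denom l.
  by have [l' l'E] := loc_scale_surj n (to_loc N (f u)); exists l', n, u.
- move=> r l k l' k' [i [u [lu l'u]]] [j [v [kv k'v]]].
  exists (i + j)%N, ((r * x ^+ j) *: u + x ^+ i *: v).
  rewrite (linearP f) (linearZ_LR f) !(linearP (to_loc _)).
  rewrite !(linearZ_LR (to_loc _)) -lu -l'u -kv -k'v !scalerDr !scalerA exprD.
  have -> : x ^+ i * x ^+ j * r = r * x ^+ j * x ^+ i by rewrite mulrC [_ * x ^+
    j]mulrC mulrA.
  by [].
- move=> [n [u [/esym]]]; rewrite scaler0 => /to_loc_eq0[k uk] l'u.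
  apply: (@loc_scale_inj _ (k + n)); rewrite exprD -scalerA l'u -linearZ_LR.
  by rewrite -linearZ_LR uk !linear0.
exists g => u; have [n [v [uv gv]]] := gP (to_loc M u).
apply/eqP; rewrite -subr_eq0; apply/eqP/(@loc_scale_inj _ n).
rewrite scalerBr gv -linearZ_LR -linearB -linearZ_LR -linearB.
have /to_loc_eq0[k uk] : to_loc M (v - x ^+ n *: u) = 0.
  by rewrite linearB -uv linearZ_LR subrr.
by apply/to_loc_eq0; exists k; rewrite -linearZ_LR uk linear0.
Qed.

Definition loc_map M N (f : {linear M -> N}) : {linear loc M -> loc N} :=
  sval (cid (loc_map_ex f)).

Lemma loc_mapE M N (f : {linear M -> N}) u :
  loc_map f (to_loc M u) = to_loc N (f u).
Proof. exact: svalP (cid (loc_map_ex f)) u. Qed.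

Lemma loc_map_comp0 A B C (f : {linear A -> B}) (g : {linear B -> C}) :
  (forall a, g (f a) = 0) -> forall l, loc_map g (loc_map f l) = 0.
Proof.
move=> gf l; have [n [u lu]] := loc_denom l.
apply: (@loc_scale_inj _ n); rewrite -!linearZ_LR lu !loc_mapE gf.
exact: linear0.
Qed.

Lemma loc_map_sq A B C D (f : {linear A -> B}) (g : {linear B -> D})
    (h : {linear A -> C}) (k : {linear C -> D}) :
  (forall a, g (f a) = k (h a)) ->
  forall l, loc_map g (loc_map f l) = loc_map k (loc_map h l).
Proof.
move=> sq l; have [n [u lu]] := loc_denom l.
apply/eqP; rewrite -subr_eq0; apply/eqP/(@loc_scale_inj _ n).
by rewrite scalerBr -!linearZ_LR lu !loc_mapE sq subrr.
Qed.

Lemma loc_map_exact A B C (f : {linear A -> B}) (g : {linear B -> C}) :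
  (forall b, g b = 0 -> exists a, f a = b) ->
  forall l, loc_map g l = 0 -> exists k, loc_map f k = l.
Proof.
move=> ex l gl; have [n [b lb]] := loc_denom l.
have /to_loc_eq0[k bk] : to_loc C (g b) = 0.
  by rewrite -loc_mapE -lb linearZ_LR gl scaler0.
have [|a fa] := ex (x ^+ k *: b); first by rewrite linearZ_LR.
have [l' l'E] := loc_scale_surj (k + n) (to_loc A a).
exists l'; apply/eqP; rewrite -subr_eq0; apply/eqP/(@loc_scale_inj _ (k + n)).
by rewrite scalerBr -linearZ_LR l'E loc_mapE fa exprD -scalerA lb linearZ_LR subrr.
Qed.

Lemma loc_map_inj A B (f : {linear A -> B}) : injective f -> injective (loc_map f).
Proof.
move=> finj; apply: inj_lin0 => l fl; have [n [a la]] := loc_denom l.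
have /to_loc_eq0[k ak] : to_loc B (f a) = 0.
  by rewrite -loc_mapE -la linearZ_LR fl scaler0.
apply: (@loc_scale_inj _ n); rewrite la; apply/to_loc_eq0; exists k.
by apply: finj; rewrite linearZ_LR ak linear0.
Qed.

Lemma loc_map_surj A B (f : {linear A -> B}) : (forall b, exists a, f a = b) ->
  forall l, exists k, loc_map f k = l.
Proof.
move=> fs l; have [n [b lb]] := loc_denom l; have [a fa] := fs b.
have [k kE] := loc_scale_surj n (to_loc A a); exists k.
apply/eqP; rewrite -subr_eq0; apply/eqP/(@loc_scale_inj _ n).
by rewrite scalerBr -linearZ_LR kE loc_mapE fa lb subrr.
Qed.

Lemma loc_map_ses A B C (f : {linear A -> B}) (g : {linear B -> C}) :
  ses f g -> ses (loc_map f) (loc_map g).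
Proof.
move=> [finj ex gs]; split.
- exact: loc_map_inj.
- move=> b; split; first by apply: loc_map_exact => b' /ex.
  by move=> [a <-]; apply: loc_map_comp0 => a'; apply/ex; exists a'.
- exact: loc_map_surj.
Qed.

Lemma loc_trivial M : (forall u : M, exists n, x ^+ n *: u = 0) ->
  trivial_mod (loc M).
Proof.
move=> tors l; have [n [u lu]] := loc_denom l.
by apply: (@loc_scale_inj _ n); rewrite lu; apply/to_loc_eq0.
Qed.

End Localization.

(** * Cochain complexes and the long exact sequence *)

Section Complexes.
Variables (R : comNzRingType).

Record complex := Complex {
  cx : nat -> lmodType R;
  cd : forall n, {linear cx n -> cx n.+1};
  cdd : forall n u, cd n.+1 (cd n u) = 0 }.

Record cmap (C D : complex) := CMap {
  cm : forall n, {linear cx C n -> cx D n};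
  cmd : forall n u, cm n.+1 (cd C n u) = cd D n (cm n u) }.

Section Cohomology.
Variable (C : complex).

Definition bnd n : set (cx C n) :=
  if n is n'.+1 return set (cx C n) then [set cd C n' u | u in setT] else [set 0].

Lemma submod_bnd n : submod (bnd (n := n)).
Proof. by case: n => [|n]; [apply: submod_set0|apply: submod_image]. Qed.

Lemma bnd_cyc n (u : cx C n) : bnd u -> cd C n u = 0.
Proof.
by case: n u => [u ->|n u [v _ <-]]; [apply: linear0|apply: cdd].
Qed.

Definition coh n : lmodType R :=
  quom (submod_preimage (sincl (submod_kernel (cd C n))) (submod_bnd n)).

(** The cocycle u represents the class xi. Diagram chases go through this relation, so the quotient
    itself is not opened again. *)
Definition rep n (u : cx C n) (xi : coh n) : Prop :=
  exists z, sincl (submod_kernel (cd C n)) z = u /\ quo _ z = xi.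

Lemma rep_ex n (xi : coh n) : exists u, rep u xi.
Proof. by have [z <-] := quo_surj xi; exists (sincl _ z), z. Qed.

Lemma rep_tot n (u : cx C n) : cd C n u = 0 -> exists xi : coh n, rep u xi.
Proof.
by case/(sincl_surj (submod_kernel (cd C n))) => z zu; exists (quo _ z), z.
Qed.

Lemma rep_cyc n (u : cx C n) (xi : coh n) : rep u xi -> cd C n u = 0.
Proof. by case=> z [<- _]; apply: (@sinclP _ _ _ (submod_kernel _) z). Qed.

Lemma repL n r (u v : cx C n) (xi eta : coh n) :
  rep u xi -> rep v eta -> rep (r *: u + v) (r *: xi + eta).
Proof.
by move=> [z [<- <-]] [w [<- <-]]; exists (r *: z + w); rewrite !linearP.
Qed.

Lemma rep0 n (u : cx C n) : rep u (0 : coh n) <-> bnd u.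
Proof.
split=> [[z [<- /quo_eq0]]//|bu].
have [z zu] := sincl_surj (submod_kernel (cd C n)) (bnd_cyc bu).
by exists z; split=> //; apply/quo_eq0; rewrite /preimage/= zu.
Qed.

Lemma repB n (u v : cx C n) (xi eta : coh n) :
  rep u xi -> rep v eta -> rep (u - v) (xi - eta).
Proof. by move=> h k; have := repL (-1) k h;
  rewrite !scaleN1r addrC [- eta + _]addrC. Qed.

Lemma repZ n r (u : cx C n) (xi : coh n) : rep u xi -> rep (r *: u) (r *: xi).
Proof.
move=> h; have /rep0 h0 : bnd (0 : cx C n) by apply: submod0 (submod_bnd n).
by have := repL r h h0; rewrite !addr0.
Qed.

Lemma rep_inj n (u : cx C n) (xi eta : coh n) : rep u xi -> rep u eta -> xi = eta.
Proof.
move=> h k; have [z [+ zxe]] := repB h k; rewrite subrr => z0.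
apply/eqP; rewrite -subr_eq0 -zxe; apply/eqP/quo_eq0.
by rewrite /preimage/= z0; apply: submod0 (submod_bnd n).
Qed.

End Cohomology.

Lemma bnd_cm C D (f : cmap C D) n (u : cx C n) : bnd u -> bnd (cm f n u).
Proof.
case: n u => [u ->|n u [v _ <-]]; first exact: linear0.
by exists (cm f n v); rewrite // cmd.
Qed.

Lemma cohmap_ex C D (f : cmap C D) n : exists g : {linear coh C n -> coh D n},
  forall u xi, rep u xi -> rep (cm f n u) (g xi).
Proof.
pose rel (xi : coh C n) (eta : coh D n) := exists u, rep u xi /\ rep (cm f n u) eta.
have [||eta|g gP] := @linear_of_rel _ _ _ rel.
- move=> xi; have [u uxi] := rep_ex xi.
  have [|eta etaP] := @rep_tot D n (cm f n u); last by exists eta, u.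
  by rewrite -cmd (rep_cyc uxi) linear0.
- move=> r xi xi' eta eta' [u [h k]] [u' [h' k']]; exists (r *: u + u').
  by rewrite linearP; split; apply: repL.
- by move=> [u [/rep0/(bnd_cm f)/rep0 h k]]; apply: rep_inj k h.
exists g => u xi uxi; have [v [vxi h]] := gP xi.
have /rep0/(bnd_cm f)/rep0 k : rep (u - v) (0 : coh C n) by rewrite -(subrr xi);
  apply: repB.
by have := repL 1 k h; rewrite scaler0 add0r scale1r linearB subrK.
Qed.

Definition cohmap C D (f : cmap C D) n : {linear coh C n -> coh D n} :=
  sval (cid (cohmap_ex f n)).

Lemma cohmapP C D (f : cmap C D) n u xi : rep u xi ->
  rep (cm f n u) (cohmap f n xi).
Proof. exact: svalP (cid (cohmap_ex f n)) u xi. Qed.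

Section LongExact.
Variables (A B C : complex) (f : cmap A B) (g : cmap B C).
Hypothesis fg : forall n, ses (cm f n) (cm g n).

(* The graph of the connecting homomorphism. *)
Definition conn n (zeta : coh C n) (alpha : coh A n.+1) : Prop :=
  exists b a, [/\ rep (cm g n b) zeta, cm f n.+1 a = cd B n b & rep a alpha].

Lemma cyc_inj n a : cd B n (cm f n a) = 0 -> cd A n a = 0.
Proof. by case: (fg n.+1) => finj _ _; rewrite -cmd => h; apply: finj;
  rewrite h linear0. Qed.

(** If the image of b is the boundary of c, subtracting from b the boundary of a lift of c leaves an
    element coming from A. Exactness at the cohomology of B and at that of C both rest on this. *)
Lemma bnd_lift n (b : cx B n) : bnd (cm g n b) ->
  exists a b', b = cm f n a + b' /\ bnd b'.
Proof.
case: n b => [b /= gb|n b [c _ /esym gb]].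
  have [_ ex _] := fg 0; have /ex[a ab] := gb.
  by exists a, 0; rewrite addr0.
have [_ _ gs] := fg n; have [b' b'c] := gs c.
have [_ ex _] := fg n.+1; have [|a ab] := (ex (b - cd B n b')).1.
  by rewrite linearB gb cmd b'c subrr.
by exists a, (cd B n b'); rewrite ab subrK; split=> //; exists b'.
Qed.

Lemma coh_exact n (eta : coh B n) :
  cohmap g n eta = 0 <-> exists xi, cohmap f n xi = eta.
Proof.
split=> [h|[xi <-]]; last first.
  have [u uxi] := rep_ex xi.
  apply: (rep_inj (cohmapP g (cohmapP f uxi))); apply/rep0.
  suff -> : cm g n (cm f n u) = 0 by apply: submod0 (submod_bnd C n).
  by have [_ ex _] := fg n; apply/ex; exists u.
have [u ueta] := rep_ex eta.
have := cohmapP g ueta; rewrite h => /rep0/bnd_lift[a [b' [ub' bb']]].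
have /rep0 b'0 := bb'.
have aeta : rep (cm f n a) eta by have := repB ueta b'0; rewrite subr0 ub' addrK.
have [xi axi] := rep_tot (cyc_inj (rep_cyc aeta)).
by exists xi; apply: rep_inj (cohmapP f axi) aeta.
Qed.

Lemma conn_ex n (zeta : coh C n) : exists alpha, conn zeta alpha.
Proof.
have [c cz] := rep_ex zeta; have [_ _ gs] := fg n; have [b bc] := gs c.
have [_ ex _] := fg n.+1; have [|a ab] := (ex (cd B n b)).1.
  by rewrite cmd bc (rep_cyc cz).
have [|alpha h] := @rep_tot A n.+1 a; first by apply: cyc_inj; rewrite ab cdd.
by exists alpha, b, a; split=> //; rewrite bc.
Qed.

Lemma connL n r (z z' : coh C n) (a a' : coh A n.+1) :
  conn z a -> conn z' a' -> conn (r *: z + z') (r *: a + a').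
Proof.
move=> [b [u [h1 h2 h3]]] [b' [u' [h1' h2' h3']]].
exists (r *: b + b'), (r *: u + u'); split; rewrite ?linearP ?h2 ?h2' //.
  exact: repL.
exact: repL.
Qed.

Lemma conn_ker n (alpha : coh A n.+1) :
  cohmap f n.+1 alpha = 0 <-> exists zeta, conn zeta alpha.
Proof.
split=> [h|[zeta [b [a [_ ab aa]]]]]; last first.
  by apply: (rep_inj (cohmapP f aa)); apply/rep0; rewrite ab; exists b.
have [a aa] := rep_ex alpha.
have := cohmapP f aa; rewrite h => /rep0[b _ ba].
have [|zeta bz] := @rep_tot C n (cm g n b); last by exists zeta, b, a.
by rewrite -cmd ba; have [_ ex _] := fg n.+1; apply/ex; exists a.
Qed.

Lemma conn0 n (zeta : coh C n) (alpha : coh A n.+1) : conn zeta alpha ->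
  alpha = 0 <-> exists eta, cohmap g n eta = zeta.
Proof.
move=> [b [a [bz ab aa]]]; split=> [a0|[eta etaz]].
  move: aa; rewrite a0 => /rep0[a' _ a'a].
  have [|eta h] := @rep_tot B n (b - cm f n a').
    by rewrite linearB -cmd a'a ab subrr.
  exists eta; have := cohmapP g h; rewrite linearB.
  have -> : cm g n (cm f n a') = 0 by have [_ ex _] := fg n; apply/ex; exists a'.
  by rewrite subr0 => k; apply: rep_inj k bz.
have [b' b'eta] := rep_ex eta.
have := repB bz (cohmapP g b'eta); rewrite etaz subrr -linearB.
move=> /rep0/bnd_lift[a' [b'' [bE /bnd_cyc b''0]]].
apply: (rep_inj aa); apply/rep0; exists a' => //.
have [finj _ _] := fg n.+1; apply: finj; rewrite ab cmd.
have -> : b = b' + (cm f n a' + b'') by rewrite -bE addrC subrK.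
by rewrite !linearD (rep_cyc b'eta) add0r b''0 addr0.
Qed.

Lemma conn_uniq n (zeta : coh C n) (alpha alpha' : coh A n.+1) :
  conn zeta alpha -> conn zeta alpha' -> alpha = alpha'.
Proof.
move=> h k; have := connL (-1) k h; rewrite scaleN1r addNr scaleN1r.
move=> /conn0[_ H]; apply/eqP; rewrite -subr_eq0 addrC; apply/eqP/H.
by exists 0; rewrite linear0.
Qed.

End LongExact.

Lemma conn_nat A B C A' B' C' (f : cmap A B) (g : cmap B C) (f' : cmap A' B')
    (g' : cmap B' C') (i : cmap A A') (j : cmap B B') (k : cmap C C') :
  (forall n u, cm j n (cm f n u) = cm f' n (cm i n u)) ->
  (forall n u, cm k n (cm g n u) = cm g' n (cm j n u)) ->
  forall n (zeta : coh C n) (alpha : coh A n.+1), conn f g zeta alpha ->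
    conn f' g' (cohmap k n zeta) (cohmap i n.+1 alpha).
Proof.
move=> sq1 sq2 n zeta alpha [b [a [bz ab aa]]].
exists (cm j n b), (cm i n.+1 a); split.
- by rewrite -sq2; apply: cohmapP.
- by rewrite -sq1 ab cmd.
- exact: cohmapP.
Qed.

End Complexes.

(** * Cones over localizations and the Cech complex *)

Section Cone.
Variable R : comNzRingType.
Implicit Types M N A B C : lmodType R.

Definition zero_mod : lmodType R := 'rV[R]_0.

Lemma zmod_trivial : trivial_mod zero_mod.
Proof. by move=> x; apply: thinmx0. Qed.

Lemma zero_linear M N : linear (fun _ : M => 0 : N).
Proof. by move=> r x y; rewrite scaler0 addr0. Qed.

Definition zmap M N : {linear M -> N} := lin (@zero_linear M N).

Section ConeDef.
Variables (x : R) (C : complex R).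

(** The localized complex moved up one degree; the cone below is the mapping fibre of C -> C_x.
    Cases on the degree avoid transport along equalities of degrees. *)
Definition shl n : lmodType R := if n is n'.+1 then loc x (cx C n') else zero_mod.

Definition shl_d n : {linear shl n -> shl n.+1} :=
  match n with 0%N => zmap zero_mod _ | n'.+1 => loc_map x (cd C n') end.

Definition cone_cx n : lmodType R := (cx C n * shl n)%type.

Definition cone_df n (w : cone_cx n) : cone_cx n.+1 :=
  (cd C n w.1, to_loc x (cx C n) w.1 - shl_d n w.2).

Lemma cone_d_linear n : linear (@cone_df n).
Proof.
move=> r [u v] [u' v']; rewrite /cone_df; congr pair => /=; first exact: linearP.
rewrite (linearP (to_loc x (cx C n))) (linearP (shl_d n)).
by rewrite scalerBr opprD addrACA.
Qed.

Definition cone_d n : {linear cone_cx n -> cone_cx n.+1} := lin (@cone_d_linear n).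

Lemma cone_dE n u v :
  cone_d n (u, v) = (cd C n u, to_loc x (cx C n) u - shl_d n v).
Proof. by []. Qed.

Lemma shl_dd n v : shl_d n.+1 (shl_d n v) = 0.
Proof.
case: n v => [|n] v /=; first exact: linear0.
by apply: loc_map_comp0; apply: cdd.
Qed.

Lemma cone_dd n w : cone_d n.+1 (cone_d n w) = 0.
Proof.
case: w => u v; rewrite !cone_dE cdd; congr pair.
by rewrite (linearB (shl_d n.+1)) shl_dd subr0 /= loc_mapE subrr.
Qed.

Definition cone : complex R := Complex cone_dd.

End ConeDef.

Section ConeMap.
Variables (x : R) (C D : complex R) (f : cmap C D).

Definition shl_m n : {linear shl x C n -> shl x D n} :=
  match n with 0%N => zmap zero_mod _ | n'.+1 => loc_map x (cm f n') end.

Definition cone_mf n (w : cone_cx x C n) : cone_cx x D n :=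
  (cm f n w.1, shl_m n w.2).

Lemma cone_m_linear n : linear (@cone_mf n).
Proof. by move=> r [u v] [u' v']; congr pair; exact: linearP. Qed.

Lemma cone_m_comm n u :
  lin (@cone_m_linear n.+1) (cd (cone x C) n u) = cd (cone x D) n (lin
    (@cone_m_linear n) u).
Proof.
case: u => u v; congr pair; first exact: cmd.
rewrite /= linearB loc_mapE; congr (_ - _).
case: n u v => [|n] u v /=; first by rewrite !linear0.
by apply: loc_map_sq => a; apply: cmd.
Qed.

Definition conem : cmap (cone x C) (cone x D) :=
  @CMap R (cone x C) (cone x D) (fun n => lin (@cone_m_linear n)) cone_m_comm.

End ConeMap.

Lemma zmod_ses A B C (f : {linear A -> B}) (g : {linear B -> C}) :
  trivial_mod A -> trivial_mod B -> trivial_mod C -> ses f g.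
Proof.
move=> A0 B0 C0; split.
- by move=> x y _; rewrite (A0 x) (A0 y).
- by move=> b; split=> _ //; exists 0; rewrite (B0 b) linear0.
- by move=> c; exists 0; rewrite (C0 c) linear0.
Qed.

Lemma conem_ses x (A B C : complex R) (f : cmap A B) (g : cmap B C) n :
  (forall n, ses (cm f n) (cm g n)) -> ses (cm (conem x f) n) (cm (conem x g) n).
Proof.
move=> fg; have [f1 f2 f3] := fg n.
have [s1 s2 s3] : ses (shl_m x f n) (shl_m x g n).
  case: n {f1 f2 f3} => [|n]; first by apply: zmod_ses; apply: zmod_trivial.
  exact: loc_map_ses.
split.
- by move=> [u v] [u' v'] [] /f1 -> /s1 ->.
- move=> [u v]; split; first by move=> [] /f2[a <-] /s2[b <-]; exists (a, b).
  move=> [[a b] [<- <-]]; congr pair; first by apply/f2; exists a.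
  by apply/s2; exists b.
- by move=> [u v]; have [a <-] := f3 u; have [b <-] := s3 v; exists (a, b).
Qed.

Definition cpt_cx M n : lmodType R := if n is 0%N then M else zero_mod.

Definition cpt_d M n : {linear cpt_cx M n -> cpt_cx M n.+1} := zmap _ _.

Lemma cpt_dd M n u : @cpt_d M n.+1 (cpt_d M n u) = 0.
Proof. by []. Qed.

Definition cpt M : complex R := Complex (@cpt_dd M).

Section CptMap.
Variables (M N : lmodType R) (f : {linear M -> N}).

Definition cpt_m n : {linear cpt_cx M n -> cpt_cx N n} :=
  match n with 0%N => f | n'.+1 => zmap zero_mod zero_mod end.

Lemma cpt_m_comm n u : cpt_m n.+1 (cd (cpt M) n u) = cd (cpt N) n (cpt_m n u).
Proof. by []. Qed.

Definition cptm : cmap (cpt M) (cpt N) :=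
  @CMap R (cpt M) (cpt N) cpt_m cpt_m_comm.
End CptMap.

Fixpoint cech (s : seq R) M : complex R :=
  if s is x :: s' then cone x (cech s' M) else cpt M.

Fixpoint cechm (s : seq R) M N (f : {linear M -> N}) : cmap (cech s M) (cech s N) :=
  if s is x :: s' then conem x (cechm s' f) else cptm f.

Lemma cechm_ses s A B C (f : {linear A -> B}) (g : {linear B -> C}) n :
  ses f g -> ses (cm (cechm s f) n) (cm (cechm s g) n).
Proof.
move=> fg; elim: s n => [|x s IH] n /=; last exact: conem_ses.
by case: n => [|n] //; apply: zmod_ses; apply: zmod_trivial.
Qed.

Lemma cechm_comp s A B C (f : {linear A -> B}) (g : {linear B -> C})
    (h : {linear A -> C}) : (forall a, h a = g (f a)) ->
  forall n u, cm (cechm s h) n u = cm (cechm s g) n (cm (cechm s f) n u).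
Proof.
move=> hgf; elim: s => [|x s IH] n /=.
  by case: n => [|n] u //=; rewrite hgf.
move=> [u v]; rewrite /= /cone_mf /= IH; congr pair.
case: n u v => [|n] u0 v //=.
have [k [u lu]] := loc_denom v.
apply/eqP; rewrite -subr_eq0; apply/eqP/(@loc_scale_inj _ _ _ k).
by rewrite scalerBr -!linearZ_LR lu !loc_mapE IH subrr.
Qed.

Lemma cechm_scale s A r (f : {linear A -> A}) : (forall a, f a = r *: a) ->
  forall n u, cm (cechm s f) n u = r *: u.
Proof.
move=> fr; elim: s => [|x s IH] n /=.
  by case: n => [|n] u //=; rewrite [RHS]zmod_trivial.
move=> [u v]; rewrite /= /cone_mf /= IH; congr pair.
case: n u v => [|n] u0 v /=; first by rewrite [RHS]zmod_trivial.
have [k [u lu]] := loc_denom v.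
apply/eqP; rewrite -subr_eq0; apply/eqP/(@loc_scale_inj _ _ _ k).
rewrite scalerBr -(linearZ_LR (loc_map _ _)) lu loc_mapE IH.
by rewrite scalerA [_ * r]mulrC -scalerA lu (linearZ_LR (to_loc _ _)) subrr.
Qed.

Definition cech_coh (s : seq R) n M : lmodType R := coh (cech s M) n.

Definition cech_map s n M N (f : {linear M -> N}) : {linear cech_coh s n M ->
  cech_coh s n N} :=
  cohmap (cechm s f) n.

End Cone.

(** * Cech cohomology: exact sequences, degree zero, torsion *)

Section CechCohomology.
Variable R : comNzRingType.
Implicit Types (M N A B C D : lmodType R) (s : seq R).

Lemma Hm_comp s n A B C (f : {linear A -> B}) (g : {linear B -> C})
    (h : {linear A -> C}) : (forall a, h a = g (f a)) ->
  forall xi : cech_coh s n A, cech_map s n h xi = cech_map s n g (cech_map s n f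
    xi).
Proof.
move=> hgf xi; have [u uxi] := rep_ex xi.
apply: rep_inj (cohmapP _ uxi) _; rewrite (cechm_comp hgf).
exact/cohmapP/cohmapP.
Qed.

Lemma Hm_scale s n A r (f : {linear A -> A}) : (forall a, f a = r *: a) ->
  forall xi : cech_coh s n A, cech_map s n f xi = r *: xi.
Proof.
move=> fr xi; have [u uxi] := rep_ex xi.
by apply: rep_inj (cohmapP _ uxi) _; rewrite (cechm_scale fr); apply: repZ.
Qed.

Lemma H_trivial s n A : trivial_mod A -> trivial_mod (cech_coh s n A).
Proof.
(* On a zero module the zero map is multiplication by 1 and by 0 at once, so 1 = 0 on the
   cohomology. *)
move=> A0 xi; have E a r : zmap A A a = r *: a by rewrite [RHS]A0.
by rewrite -[xi]scale1r -(Hm_scale (E^~ 1)) (Hm_scale (E^~ 0)) scale0r.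
Qed.

Section LongExactSequence.
Variables (s : seq R) (A B C : lmodType R).
Variables (f : {linear A -> B}) (g : {linear B -> C}).
Hypothesis fg : ses f g.

Let cfg n : ses (cm (cechm s f) n) (cm (cechm s g) n) := cechm_ses s n fg.

Definition connecting n (zeta : cech_coh s n C) (alpha : cech_coh s n.+1 A) :
  Prop :=
  conn (cechm s f) (cechm s g) zeta alpha.

Lemma H_exact n (eta : cech_coh s n B) :
  cech_map s n g eta = 0 <-> exists xi, cech_map s n f xi = eta.
Proof. exact: (coh_exact cfg). Qed.

Lemma connecting_ex n (zeta : cech_coh s n C) : exists alpha, connecting zeta alpha.
Proof. exact: (conn_ex cfg). Qed.

Lemma connectingL n r (z z' : cech_coh s n C) (a a' : cech_coh s n.+1 A) :
  connecting z a -> connecting z' a' -> connecting (r *: z + z') (r *: a + a').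
Proof. exact: connL. Qed.

Lemma connecting_ker n (alpha : cech_coh s n.+1 A) :
  cech_map s n.+1 f alpha = 0 <-> exists zeta, connecting zeta alpha.
Proof. exact: (conn_ker cfg). Qed.

Lemma connecting_eq0 n (zeta : cech_coh s n C) (alpha : cech_coh s n.+1 A) :
  connecting zeta alpha -> alpha = 0 <-> exists eta, cech_map s n g eta = zeta.
Proof. exact: (conn0 cfg). Qed.

Lemma connecting_uniq n (zeta : cech_coh s n C) (alpha alpha' : cech_coh s n.+1 A) :
  connecting zeta alpha -> connecting zeta alpha' -> alpha = alpha'.
Proof. exact: (conn_uniq cfg). Qed.

Lemma connecting0 n : connecting (0 : cech_coh s n C) 0.
Proof.
have [a za] := connecting_ex (0 : cech_coh s n C).
suff a0 : a = 0 by rewrite a0 in za.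
by apply/(connecting_eq0 za); exists 0; rewrite linear0.
Qed.

Lemma connectingZ n r (z : cech_coh s n C) (a : cech_coh s n.+1 A) :
  connecting z a -> connecting (r *: z) (r *: a).
Proof. by move=> za; have := connectingL r za (connecting0 n); rewrite !addr0. Qed.

Lemma Hm_surj n : trivial_mod (cech_coh s n.+1 A) ->
  forall zeta, exists eta, cech_map s n g eta = zeta.
Proof.
move=> A0 zeta; have [a za] := connecting_ex zeta.
exact/(connecting_eq0 za).
Qed.

Lemma Hm_inj n : (forall zeta, exists eta, cech_map s n g eta = zeta) ->
  injective (cech_map s n.+1 f).
Proof.
move=> gs; apply: inj_lin0 => a /connecting_ker[z za].
exact/(connecting_eq0 za).
Qed.

Lemma H_trivial_ext n :
  trivial_mod (cech_coh s n A) -> trivial_mod (cech_coh s n C) ->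
    trivial_mod (cech_coh s n B).
Proof.
by move=> A0 C0 x; have /H_exact[y <-] := C0 (cech_map s n g x);
  rewrite (A0 y) linear0.
Qed.

End LongExactSequence.

Lemma connecting_nat s A B C A' B' C' (f : {linear A -> B}) (g : {linear B -> C})
    (f' : {linear A' -> B'}) (g' : {linear B' -> C'})
    (i : {linear A -> A'}) (j : {linear B -> B'}) (k : {linear C -> C'}) :
  (forall u, j (f u) = f' (i u)) -> (forall u, k (g u) = g' (j u)) ->
  forall n (zeta : cech_coh s n C) (alpha :
    cech_coh s n.+1 A), connecting f g zeta alpha ->
    connecting f' g' (cech_map s n k zeta) (cech_map s n.+1 i alpha).
Proof.
move=> jf kg n z a.
have sq (X Y X' Y' : lmodType R) (h : {linear X -> Y}) (l : {linear Y -> Y'})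
    (h' : {linear X' -> Y'}) (l' : {linear X -> X'}) :
    (forall u, l (h u) = h' (l' u)) -> forall q u,
    cm (cechm s l) q (cm (cechm s h) q u) = cm (cechm s h') q (cm (cechm s l') q u).
  move=> lh q u; rewrite -(cechm_comp (h := l \o h)) //.
  by rewrite (cechm_comp (h := l \o h) lh).
exact: (conn_nat (sq _ _ _ _ _ _ _ _ jf) (sq _ _ _ _ _ _ _ _ kg)).
Qed.

(** In degree 0 the complex is M padded with zero modules, which [aug] strips off; the 0-cocycles
    become the torsion elements of M. *)
Fixpoint aug s M : cx (cech s M) 0 -> M :=
  if s is x :: s' return cx (cech s M) 0 -> M then fun w => aug w.1 else id.

Lemma aug_linear s M : linear (@aug s M).
Proof. by elim: s => [|x s IH] //= r u v; rewrite IH. Qed.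

Lemma aug_eq0 s M (u : cx (cech s M) 0) : aug u = 0 -> u = 0.
Proof.
elim: s u => [|x s IH] //= [u v] /= /IH ->; congr pair; exact: zmod_trivial.
Qed.

Lemma aug_surj s M u : exists w, @aug s M w = u.
Proof.
elim: s => [|x s [w <-]] /=; first by exists u.
by exists (w, 0).
Qed.

Lemma aug_nat s M N (f : {linear M -> N}) w : aug (cm (cechm s f) 0 w) = f (aug w).
Proof. by elim: s w => [|x s IH] //= w; rewrite IH. Qed.

Lemma aug_cyc s M w : cd (cech s M) 0 w = 0 <->
  forall x, x \in s -> exists k, x ^+ k *: aug w = 0.
Proof.
elim: s w => [|x s IH] //= [u v] /=.
have torsE k : (x ^+ k *: u = 0) <-> (x ^+ k *: aug u = 0).
  rewrite -(linearZ_LR (lin (@aug_linear s M))); split; last exact: aug_eq0.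
  by move=> ->; rewrite linear0.
split.
  move=> [/IH us]; rewrite subr0 => /to_loc_eq0[k /torsE ku] y.
  by rewrite inE => /orP[/eqP->|/us//]; exists k.
move=> h; congr pair.
  by apply/IH => y ys; apply: h; rewrite inE ys orbT.
rewrite /= subr0; apply/to_loc_eq0.
by have [|k /torsE ku] := h x; [rewrite inE eqxx|exists k].
Qed.

Lemma H0_ex s M : exists f : {linear cech_coh s 0 M -> M},
  forall w xi, rep w xi -> f xi = aug w.
Proof.
pose rel (xi : cech_coh s 0 M) u := exists2 w, rep w xi & aug w = u.
have [||u|f fP] := @linear_of_rel _ _ _ rel.
- by move=> xi; have [w wxi] := rep_ex xi; exists (aug w), w.
- move=> r xi eta _ _ [w h <-] [w' h' <-]; exists (r *: w + w'); first exact: repL.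
  exact: aug_linear.
- by move=> [w /rep0/= -> <-]; apply: (linear0 (lin (@aug_linear s M))).
exists f => w xi wxi; have [w' w'xi <-] := fP xi.
have := repB w'xi wxi; rewrite subrr => /rep0/= /eqP; rewrite subr_eq0.
by move=> /eqP->.
Qed.

Definition H0_incl s M : {linear cech_coh s 0 M -> M} := sval (cid (H0_ex s M)).

Lemma H0_inclE s M w (xi : cech_coh s 0 M) : rep w xi -> H0_incl s M xi = aug w.
Proof. exact: svalP (cid (H0_ex s M)) w xi. Qed.

Lemma H0_incl_inj s M : injective (H0_incl s M).
Proof.
apply: inj_lin0 => xi; have [w wxi] := rep_ex xi.
rewrite (H0_inclE wxi) => /aug_eq0 w0; apply: rep_inj wxi _.
by apply/rep0; rewrite w0.
Qed.

Lemma H0_incl_nat s M N (f : {linear M -> N}) (xi : cech_coh s 0 M) :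
  H0_incl s N (cech_map s 0 f xi) = f (H0_incl s M xi).
Proof.
have [w wxi] := rep_ex xi.
by rewrite (H0_inclE wxi) (H0_inclE (cohmapP (cechm s f) wxi)) aug_nat.
Qed.

Lemma H0_incl_img s M u : (exists xi, H0_incl s M xi = u) <->
  forall x, x \in s -> exists k, x ^+ k *: u = 0.
Proof.
split=> [[xi <-]|h].
  by have [w wxi] := rep_ex xi; rewrite (H0_inclE wxi); apply/aug_cyc/(rep_cyc wxi).
have [w wu] := aug_surj s u; have [|xi wxi] := @rep_tot _ (cech s M) 0%N w.
  by apply/aug_cyc; rewrite wu.
by exists xi; rewrite (H0_inclE wxi).
Qed.

Lemma cech_torsion x s M n : (forall u : M, exists k, x ^+ k *: u = 0) ->
  forall u : cx (cech s M) n, exists k, x ^+ k *: u = 0.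
Proof.
move=> tors; elim: s n => [|y s IH] n /=.
  by case: n => [|n] u //=; exists 0%N; apply: zmod_trivial.
move=> [u v]; have [k ku] := IH n u.
suff [j jv] : exists j, x ^+ j *: v = 0.
  exists (k + j)%N; congr pair => /=.
    by rewrite exprD mulrC -scalerA ku scaler0.
  by rewrite exprD -scalerA jv scaler0.
case: n u ku v => [|n] _ _ v /=; first by exists 0%N; apply: zmod_trivial.
have [i [w vw]] := loc_denom v; have [j jw] := IH n w.
exists j; apply: (@loc_scale_inj _ _ _ i).
by rewrite scalerA mulrC -scalerA vw -(linearZ_LR (to_loc _ _)) jw linear0.
Qed.

(** All localizations of such an M vanish, so the complex itself is zero in positive degrees. *)
Lemma H_torsion_trivial s M n :
  (forall x, x \in s -> forall u : M, exists k, x ^+ k *: u = 0) ->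
  trivial_mod (cech_coh s n.+1 M).
Proof.
move=> tors xi; have [u uxi] := rep_ex xi; apply: rep_inj uxi _.
suff -> : u = 0 by apply/rep0; exact: submod0 (submod_bnd _ _).
elim: s tors n u {xi} => [|x s IH] tors n u /=; first exact: zmod_trivial.
case: u => u v; congr pair.
  by apply: IH => y ys; apply: tors; rewrite inE ys orbT.
by apply: loc_trivial; apply: cech_torsion; apply: tors; rewrite inE eqxx.
Qed.

(** After inverting x the map C -> C_x is an isomorphism and the cone is acyclic. Concretely,
    clearing the denominator of v gives a w such that a power of x times (u, v) is the boundary of
    (x^j w, 0). *)
Lemma cone_torsion x (C : complex R) n w : cd (cone x C) n w = 0 ->
  exists k, bnd (x ^+ k *: w).
Proof.
case: n w => [|n] [u v] /= [du].
  rewrite subr0 => /to_loc_eq0[k ku]; exists k.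
  by congr pair => //; apply: zmod_trivial.
move=> /eqP; rewrite subr_eq0 => /eqP /= uv.
have [k [w kv]] := loc_denom v.
have /to_loc_eq0[j ju] : to_loc x _ (x ^+ k *: u - cd C n w) = 0.
  by rewrite linearB linearZ_LR uv -loc_mapE -kv linearZ_LR subrr.
exists (j + k)%N; exists (x ^+ j *: w, 0) => //.
rewrite /cone_df /= (linear0 (shl_d _ _ _)) subr0; congr pair.
  apply/eqP; rewrite eq_sym -subr_eq0; rewrite linearZ_LR.
  by rewrite exprD /= -scalerA -scalerBr ju.
by rewrite /= linearZ_LR -kv scalerA -exprD.
Qed.

(** In the long exact sequence of the cone the terms come from C and from C_x, both with y-torsion
    cohomology; the two are treated in turn on a cocycle (u, v). *)
Lemma cone_torsion_pres x y (C : complex R) :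
  (forall n u, cd C n u = 0 -> exists k, bnd (y ^+ k *: u)) ->
  forall n w, cd (cone x C) n w = 0 -> exists k, bnd (y ^+ k *: w).
Proof.
move=> tors [|n] [u v] /= [du].
  move=> _; have [k /= ku] := tors _ _ du; exists k.
  by congr pair => //; apply: zmod_trivial.
move=> /eqP; rewrite subr_eq0 => /eqP /= uv.
have [k [w _ wu]] := tors _ _ du.
(* Subtracting the boundary of (w, 0) from y^k (u, v) leaves (0, v'). *)
pose v' := y ^+ k *: v - to_loc x _ w.
have dv' : loc_map x (cd C n) v' = 0.
  by rewrite linearB linearZ_LR -uv loc_mapE wu linearZ_LR subrr.
have [i [z iz]] := loc_denom v'.
have /to_loc_eq0[j jz] : to_loc x _ (cd C n z) = 0.
  by rewrite -loc_mapE -iz linearZ_LR dv' scaler0.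
have [|l zb] := tors n (x ^+ j *: z); first by rewrite linearZ_LR.
suff [t tv'] : exists t, shl_d x C n t = y ^+ l *: v'.
  exists (l + k)%N; exists (y ^+ l *: w, - t) => //.
  rewrite /cone_df /=; congr pair.
    by rewrite linearZ_LR wu scalerA -exprD.
  rewrite (linearN (shl_d _ _ _)) opprK tv' /v' scalerBr linearZ_LR.
  by rewrite addrC subrK scalerA -exprD.
have Ev' : x ^+ (j + i) *: (y ^+ l *: v') = to_loc x _ (y ^+ l *: (x ^+ j *: z)).
  by rewrite !(linearZ_LR (to_loc _ _)) -iz !scalerA exprD; congr (_ *: _);
    rewrite mulrC mulrA.
clearbody v'; clear uv wu dv' jz du iz.
case: n u v w v' z zb Ev' => [|n] u v w v' z zb Ev'.
  exists 0; rewrite linear0; apply/esym/(@loc_scale_inj _ _ _ (j + i)).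
  by rewrite Ev' /= in zb *; rewrite zb linear0.
have [z' _ z'E] := zb; have [t tE] := loc_scale_surj (j + i) (to_loc x _ z').
exists t => /=; apply/eqP; rewrite -subr_eq0;
  apply/eqP/(@loc_scale_inj _ _ _ (j + i)).
by rewrite scalerBr Ev' -z'E -(linearZ_LR (loc_map _ _)) tE loc_mapE subrr.
Qed.

Lemma H_torsion s n M x (xi : cech_coh s n M) : x \in s ->
  exists k, x ^+ k *: xi = 0.
Proof.
move=> xs; have [u uxi] := rep_ex xi.
suff tors : forall n u, cd (cech s M) n u = 0 -> exists k, bnd (x ^+ k *: u).
  have [k kb] := tors _ _ (rep_cyc uxi); exists k.
  by apply: rep_inj (repZ _ uxi) _; apply/rep0.
elim: s xs {n xi u uxi} => [|y s IH] //; rewrite inE => /orP[/eqP<- n w|/IH h].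
  exact: cone_torsion.
exact: cone_torsion_pres.
Qed.

End CechCohomology.

(** * Injective modules are acyclic for the Cech complex *)

Section Comparison.
Variable R : comNzRingType.
Hypothesis NR : noeth (R^o : lmodType R).
Implicit Types (M N A B C D E : lmodType R) (s : seq R).

Lemma stable_annihilator M x (S : set M) : submod S -> noeth M ->
  exists k, forall j u, (k <= j)%N -> S (x ^+ j *: u) -> S (x ^+ k *: u).
Proof.
move=> SP NM.
have [||k kP] := @noeth_chain R M (fun n => [set u | S (x ^+ n *: u)]) NM.
- by move=> n; exact: (submod_preimage (smul M (x ^+ n)) SP).
- by move=> n u /= Su; rewrite exprS -scalerA; apply: submodZ.
exists k => j u kj Sj; have := kP _ kj.
by move/seteqP => [+ _]; apply.
Qed.

(* Artin-Rees for the principal ideal (x ^+ (n + k)), in its weak form: an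
   ideal J maximal among those meeting it in x ^+ (n + k) * annv e contains a
   power of every y in s, and j + x ^+ (n + k) * r |-> x ^+ k * r * e is well
   defined on J + (x ^+ (n + k)). *)
Lemma injective_divisible E s x n (e : E) : injective_module E ->
  (forall y, y \in s -> exists k, y ^+ k *: e = 0) ->
  exists (e' : E) k, (forall y, y \in s -> exists k, y ^+ k *: e' = 0) /\
    x ^+ (n + k) *: e' = x ^+ k *: e.
Proof.
move=> Einj tors.
(* From k on the annihilators of the powers of x in R are constant, so z r determines x^k r. *)
have [k kP] := stable_annihilator x (submod_set0 (R^o : lmodType R)) NR.
have {}kP r : x ^+ (n + k) * r = 0 -> x ^+ k * r = 0.
  by move=> h; apply: (kP (n + k)%N); rewrite ?leq_addl.
set z := x ^+ (n + k) in kP *.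
pose P (J : set R) := [/\ ideal J, forall r, r *: e = 0 -> J (z * r) &
  forall r, J (z * r) -> exists2 r', r' *: e = 0 & z * r = z * r'].
have [||J [[JI J1 J2] Jmax]] := NR (P := P).
- exists [set z * r | r in annv e]; split; last first.
  + by move=> r [r' h <-]; exists r'.
  + by move=> r h; exists r.
  by apply: (submod_image (smul (R^o : lmodType R) z)); apply: ideal_annv.
- by move=> J [].
have Js y : y \in s -> exists i, J (y ^+ i).
  move=> ys; have [j je] := tors y ys.
  have [i iP] := stable_annihilator y JI NR.
  (* The ideals (J : y^n) are constant from i on, and y^j kills e; with l = i + j, y^l kills e and
     (J : y^(2l)) = (J : y^l). *)
  pose l := (i + j)%N.
  have le0 : y ^+ l *: e = 0 by rewrite exprD -scalerA je scaler0.
  have lP r : J (y ^+ l * (y ^+ l * r)) -> J (y ^+ l * r).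
    rewrite mulrA -exprD => h.
    have h' : J (y ^+ i * r).
      by apply: (iP (l + l)%N); rewrite // /l -addnA leq_addr.
    by rewrite /l exprD mulrAC mulrC; apply: idealM.
  exists l.
  (* J + (y^l) is again in the family, hence equal to J by maximality. *)
  pose J' : set R := [set w | exists a b, J a /\ w = a + y ^+ l * b].
  have JJ' : J `<=` J' by move=> a Ja; exists a, 0; rewrite mulr0 addr0.
  suff <- : J' = J by exists 0, 1; rewrite mulr1 add0r; split=> //;
    apply: submod0 JI.
  apply: Jmax => //; split.
  - split=> [|r _ _ [a [b [Ja ->]]] [a' [b' [Ja' ->]]]];
    first exact/JJ'/(submod0 JI).
    exists (r * a + a'), (r * b + b'); split; first exact: JI.2.
    by rewrite /GRing.scale/= mulrDr mulrDr addrACA mulrCA.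
  - by move=> r /J1/JJ'.
  move=> r [a [b [Ja wE]]]; apply: J2.
  rewrite wE; apply: (submodD JI) => //; apply: lP.
  have -> : y ^+ l * (y ^+ l * b) = z * (y ^+ l * r) - y ^+ l * a.
    by rewrite (mulrCA z) wE mulrDr addrAC subrr add0r.
  apply: (submodB JI); last exact: idealM.
  by apply: J1; rewrite mulrC -scalerA le0 scaler0.
pose D : set (R^o : lmodType R) := [set w | exists a r, J a /\ w = a + z * r].
have DP : submod D.
  split=> [|r _ _ [a [b [Ja ->]]] [a' [b' [Ja' ->]]]].
    by exists 0, 0; rewrite mulr0 addr0; split=> //; apply: submod0 JI.
  exists (r * a + a'), (r * b + b'); split; first exact: JI.2.
  by rewrite /GRing.scale/= mulrDr mulrDr addrACA mulrCA.
have well a r : J a -> a + z * r = 0 -> (x ^+ k * r) *: e = 0.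
  move=> Ja /eqP; rewrite addrC addr_eq0 => /eqP zr.
  have [|r' r'e zr'] := J2 r; first by rewrite zr -mulN1r; exact: idealM.
  have /kP : z * (r - r') = 0 by rewrite mulrBr zr' subrr.
  rewrite mulrBr => /eqP; rewrite subr_eq0 => /eqP->.
  by rewrite -scalerA r'e scaler0.
pose rel (d : subm DP) u := exists a r,
  [/\ J a, sincl DP d = a + z * r & u = (x ^+ k * r) *: e].
have [|||g gP] := @linear_of_rel _ _ _ rel.
- by move=> d; have [a [r [Ja dE]]] := sinclP d; exists ((x ^+ k * r) *: e), a, r.
- move=> r d d' _ _ [a [b [Ja dE ->]]] [a' [b' [Ja' d'E ->]]].
  exists (r * a + a'), (r * b + b'); split; first exact: JI.2.
    by rewrite linearP dE d'E /GRing.scale/= mulrDr mulrDr addrACA mulrCA.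
  by rewrite scalerA -scalerDl mulrDr mulrCA.
- by move=> u [a [r [Ja]]]; rewrite linear0 => /esym/(well _ _ Ja) -> ->.
have [h hP] := Einj _ _ _ g (@sincl_inj _ _ _ DP).
have hE a r : J a -> h (a + z * r) = (x ^+ k * r) *: e.
  move=> Ja; have [|d dE] := @sincl_surj _ _ _ DP (a + z * r); first by exists a, r.
  have [a' [r' [Ja' d'E gE]]] := gP d.
  rewrite -dE hP gE; apply/eqP; rewrite -subr_eq0 -scalerBl -mulrBr; apply/eqP.
  apply: (well (a' - a)); first exact: (submodB JI Ja' Ja).
  rewrite mulrBr addrACA -opprD; apply/eqP; rewrite subr_eq0.
  by rewrite -d'E -dE.
have h1 r : h r = r *: h 1 by rewrite -linearZ_LR /GRing.scale/= mulr1.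
exists (h 1), k; split=> [y /Js[i Ji]|].
  by exists i; rewrite -h1; have := hE _ 0 Ji; rewrite !mulr0 addr0 scale0r.
by rewrite -h1; have := hE 0 1 (submod0 JI); rewrite add0r !mulr1.
Qed.

(** By induction on s, a cocycle becomes (0, v') modulo boundaries, with v' a cocycle of the
    localized complex. In positive degree localization preserves exactness; in degree 0 what remains
    is that the torsion of E maps onto its localization at x, which is [injective_divisible]. *)
Lemma H_injective_trivial s n E : injective_module E ->
  trivial_mod (cech_coh s n.+1 E).
Proof.
move=> Einj xi; have [u uxi] := rep_ex xi; have := rep_cyc uxi.
move=> du; apply: rep_inj uxi _; apply/rep0; move: du.
clear xi; elim: s n u => [|x s IH] n /=.
  by move=> u _; exists 0 => //; rewrite [RHS]zmod_trivial.
move=> [u v] /= [du] /eqP; rewrite subr_eq0 => /eqP uv.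
have [w _ wu] := IH _ _ du.
pose v' := v - to_loc x _ w.
have dv' : loc_map x (cd (cech s E) n) v' = 0.
  by rewrite linearB -uv loc_mapE wu subrr.
suff [w' [dw' [t tE]]] : exists w', cd (cech s E) n w' = 0 /\
    exists t, to_loc x _ w' - shl_d x _ n t = v'.
  exists (w + w', t) => //; rewrite /cone_df /=; congr pair.
    by rewrite linearD dw' addr0.
  by rewrite linearD -addrA tE addrC subrK.
clearbody v'; clear u v w du uv wu; case: n v' dv' => [|n] v' dv'; last first.
  have [|t tE] := @loc_map_exact _ x _ _ _ (cd (cech s E) n) _ _ v' dv'.
    by move=> b /IH[a _ ab]; exists a.
  by exists 0; rewrite !linear0; split=> //; exists (- t);
    rewrite linearN sub0r opprK.
have [i [z iz]] := loc_denom v'.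
have /to_loc_eq0[j jz] : to_loc x _ (cd (cech s E) 0 z) = 0.
  by rewrite -loc_mapE -iz linearZ_LR dv' scaler0.
pose z' := x ^+ j *: z.
have /aug_cyc z'tors : cd (cech s E) 0 z' = 0 by rewrite linearZ_LR.
have z'E : x ^+ (j + i) *:
  v' = to_loc x _ z' by rewrite exprD -scalerA iz linearZ_LR.
clearbody z'.
(* v' is the fraction z' / x^(j + i) with z' torsion; e' is a torsion element of E representing the
   same fraction. *)
have [e' [k [e'tors ke']]] := @injective_divisible E s x (j + i) _ Einj z'tors.
have [w' w'E] := aug_surj s e'.
exists w'; split; first by apply/aug_cyc; rewrite w'E.
exists 0; rewrite linear0 subr0.
apply/eqP; rewrite -subr_eq0; apply/eqP/(@loc_scale_inj _ _ _ (k + (j + i))).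
rewrite scalerBr exprD -![(_ * _) *:
  _]scalerA z'E -!(linearZ_LR (to_loc _ _)) -linearB.
suff -> : x ^+ k *: (x ^+ (j + i) *: w') = x ^+ k *: z' by rewrite subrr linear0.
apply/eqP; rewrite -subr_eq0; apply/eqP/aug_eq0.
have aL := linearB (lin (@aug_linear _ s E));
  have aZ := linearZ_LR (lin (@aug_linear _ s E)).
by rewrite /= in aL aZ; rewrite aL !aZ w'E scalerA mulrC -exprD ke' subrr.
Qed.

End Comparison.

(** * Comparison with local cohomology through annihilators *)

Section DerivedFunctor.
Variable R : comNzRingType.
Hypothesis NR : noeth (R^o : lmodType R).
Implicit Types (M N A B C D E : lmodType R) (s : seq R) (a I : set R).

Lemma ideal_genP (A : set R) : ideal (ideal_gen A).
Proof. exact/(submodP (ideal_gen A : set (R^o : lmodType R)))/ideal_gen_ideal. Qed.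

Lemma ideal_gen_sub (A : set R) I : ideal I -> A `<=` I -> ideal_gen A `<=` I.
Proof. by move=> II AI r; apply; split=> //;
  apply/(submodP (I : set (R^o : lmodType R))). Qed.

Lemma ideal_pow_expr a n x : a x -> ideal_pow a n (x ^+ n).
Proof.
move=> ax; elim: n => [|n IH] //.
by rewrite exprS => J [_]; apply; exists x => //; exists (x ^+ n).
Qed.

Lemma ideal_powD_sub a I i j : ideal I ->
  (forall u w, ideal_pow a i u -> ideal_pow a j w -> I (u * w)) ->
  ideal_pow a (i + j) `<=` I.
Proof.
elim: i I => [|i IH] I II sub.
  by move=> w aw; rewrite -[w]mul1r; apply: sub.
rewrite addSn; apply: ideal_gen_sub => // _ [x ax [y ay <-]].
have CI : ideal [set y | I (x * y)].
  exact: (submod_preimage (smul (R^o : lmodType R) x) II).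
apply: (IH _ CI) ay => u w au aw /=; rewrite mulrA; apply: sub => //.
by move=> J [_]; apply; exists x => //; exists u.
Qed.

(** Noetherian induction instead of counting monomials: for a maximal counterexample J and a
    generator x outside J, the larger ideals J + (x) and (J : x) contain powers a^n and a^j, so J
    contains a^(n + j). *)
Lemma ideal_pow_sub s I : ideal I ->
  (forall x, x \in s -> exists k, I (x ^+ k)) ->
  exists n, ideal_pow (ideal_gen [set` s]) n `<=` I.
Proof.
set a := ideal_gen _ => II sI; apply: contrapT => nI.
pose P J := [/\ ideal J, I `<=` J & ~ exists n, ideal_pow a n `<=` J].
have [||J [[JI IJ Jn] Jmax]] := NR (P := P); first by exists I; split.
  by move=> J [].
have [sJ|] := pselect (forall x, x \in s -> J x).
  apply: Jn; exists 1%N; apply: ideal_gen_sub => // _ [x ax [y _ <-]].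
  by rewrite mulrC; apply: idealM => //; apply: ideal_gen_sub ax.
move=> /existsNP[x /not_implyP[xs Jx]].
have [k Jk] := sI _ xs; have {}Jk := IJ _ Jk.
have big K : ideal K -> J `<=` K -> (exists2 z, K z & ~ J z) ->
    exists n, ideal_pow a n `<=` K.
  move=> KI JK [z Kz Jz]; apply: contrapT => Kn; apply: Jz.
  suff <- : K = J by [].
  by apply: Jmax => //; split=> //; apply: subset_trans JK.
have [n nJ] : exists n, ideal_pow a n `<=` [set w | exists u r, J u /\ w = u + r
  * x].
  apply: big; last first.
  - by exists x => //; exists 0, 1; rewrite mul1r add0r; split=> //;
    apply: submod0 JI.
  - by move=> u Ju; exists u, 0; rewrite mul0r addr0.
  split=> [|r _ _ [u [b [Ju ->]]] [u' [b' [Ju' ->]]]].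
    by exists 0, 0; rewrite mul0r addr0; split=> //; apply: submod0 JI.
  exists (r * u + u'), (r * b + b'); split; first exact: JI.2.
  by rewrite /GRing.scale/= mulrDr mulrDl addrACA mulrA.
have [j jJ] : exists j, ideal_pow a j `<=` [set w | J (x * w)].
  apply: big.
  - exact: (submod_preimage (smul (R^o : lmodType R) x) JI).
  - by move=> u Ju; apply: idealM.
  elim: k Jk => [|k IH] Jk; first by case: Jx; rewrite -[x]mulr1; apply: idealM.
  have [/IH//|Jk'] := pselect (J (x ^+ k)).
  by exists (x ^+ k) => //=; rewrite -exprS.
apply: Jn; exists (n + j)%N;
  apply: ideal_powD_sub => // u w /nJ[v [r [Jv ->]]] /jJ Jw.
rewrite mulrDl; apply: (submodD JI); first by rewrite mulrC; apply: idealM.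
by rewrite -mulrA; apply: idealM.
Qed.

Lemma torsion_setP s M (u : M) : torsion_set (ideal_gen [set` s]) u <->
  forall x, x \in s -> exists k, x ^+ k *: u = 0.
Proof.
split=> [[n nu] x xs|/(ideal_pow_sub (ideal_annv u))//].
exists n; apply/nu/ideal_pow_expr; exact: (@sub_gen_smallest _ _ [set` s]).
Qed.

Section Shift.
Variables (s : seq R) (A B C : lmodType R).
Variables (f : {linear A -> B}) (g : {linear B -> C}).
Hypothesis fg : ses f g.

Lemma ann_dimension_shift n : trivial_mod (cech_coh s n B) ->
  trivial_mod (cech_coh s n.+1 B) ->
  annihilator (cech_coh s n C) = annihilator (cech_coh s n.+1 A).
Proof.
move=> B0 B1; apply/seteqP; split=> r rk xi.
  have /(connecting_ker fg)[z za] :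
    cech_map s n.+1 f xi = 0 by rewrite (B1 (cech_map _ _ _ _)).
  by have := connectingZ fg r za;
    rewrite rk => /(connecting_uniq fg (connecting0 s fg n)).
have [al za] := connecting_ex fg xi.
have := connectingZ fg r za; rewrite rk => /(connecting_eq0 fg)[+ _].
by move=> /(_ erefl)[eta <-]; rewrite (B0 eta) linear0.
Qed.

(** The connecting map presents H^1(A) as the torsion of C modulo the image of the torsion of B.
    This is the form in which Cech cohomology meets the subquotient defining local cohomology. *)
Lemma ann_H1 : trivial_mod (cech_coh s 1 B) -> annihilator (cech_coh s 1 A) =
  [set r | forall c : C, (forall x, x \in s -> exists k, x ^+ k *: c = 0) ->
    exists b, (forall x, x \in s -> exists k, x ^+ k *: b = 0) /\ g b = r *: c].
Proof.
move=> B1; apply/seteqP; split=> r /= rk.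
  move=> c /H0_incl_img[z <-]; have [al za] := connecting_ex fg z.
  have := connectingZ fg r za; rewrite rk => /(connecting_eq0 fg)[+ _].
  move=> /(_ erefl)[eta etaz]; exists (H0_incl s B eta); split.
    by apply/H0_incl_img; exists eta.
  by rewrite -H0_incl_nat etaz linearZ_LR.
move=> xi.
have /(connecting_ker fg)[z za] :
  cech_map s 1 f xi = 0 by rewrite (B1 (cech_map _ _ _ _)).
apply/(connecting_eq0 fg (connectingZ fg r za)).
have [|b [/H0_incl_img[eta <-] bE]] := rk (H0_incl s C z).
  by apply/H0_incl_img; exists z.
exists eta; apply: H0_incl_inj.
by rewrite H0_incl_nat bE linearZ_LR.
Qed.

End Shift.

Lemma annihilator_subquotient M (Z B : submodule M) :
  annihilator (subquotient Z B) =
  [set r | forall z, (Z : set M) z -> (B : set M) (r *: z)].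
Proof.
apply/seteqP; split=> r /= rk.
  move=> z Zz.
  pose y : submodule_type Z := SubmoduleType (mem_set Zz : z \in submodule_mem Z).
  have := rk (\pi_(subquotient Z B) y)%qT.
  by rewrite -[_ *: _]/(quotient_scale _ _) quotient_scaleE => /quotient_pi_eq0.
move=> x; have [y ->] := quotient_piP x.
rewrite -[_ *: _]/(quotient_scale _ _) quotient_scaleE; apply/quotient_pi_eq0.
exact/rk/set_mem/(valP y).
Qed.

Section Resolution.
Variables (M : lmodType R) (E : injective_resolution M).

(** The cosyzygies. In degree 0 it is M itself rather than its image, so that the augmentation
    serves as the inclusion. *)
Definition syzygy n : lmodType R :=
  if n is n'.+1 then subm (submod_kernel (res_diff E n)) else M.

Definition syzygy_incl n : {linear syzygy n -> res_module E n} :=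
  match n with
  | 0%N => res_aug E
  | n'.+1 => sincl (submod_kernel (res_diff E n'.+1))
  end.

Lemma res_diff_exact n u :
  res_diff E n.+1 u = 0 <-> exists v, res_diff E n v = u.
Proof.
have := res_exact E n => /seteqP[h1 h2]; split; first by move/h2 => [v _ <-];
  exists v.
by move=> [v <-]; apply: h1; exists v.
Qed.

Lemma syzygy_ses n : exists g : {linear res_module E n -> syzygy n.+1},
  ses (syzygy_incl n) g /\ forall u, syzygy_incl n.+1 (g u) = res_diff E n u.
Proof.
have dd u : res_diff E n.+1 (res_diff E n u) = 0 by apply/res_diff_exact; exists u.
have [g gP] := corestr_ex (submod_kernel (res_diff E n.+1)) dd.
exists g; split=> //; split.
- by case: n {g gP dd} => [|n]; [apply: res_aug_inj|apply: sincl_inj].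
- move=> u.
  have -> : g u = 0 <-> res_diff E n u = 0.
    rewrite -gP; split=> [->|]; first exact: linear0.
    by rewrite -(linear0 (sincl (submod_kernel (res_diff E n.+1)))) => /sincl_inj.
  case: n {g gP dd} u => [|n] u /=.
    have := res_exact0 E => /seteqP[h1 h2]; split; first by move/h2 => [v _ <-];
      exists v.
    by move=> [v <-]; apply: h1; exists v.
  split; first by move/(sincl_surj (submod_kernel _)).
  by move=> [v <-]; exact: (@sinclP _ _ _ (submod_kernel _) v).
- move=> w; have := @sinclP _ _ _ (submod_kernel (res_diff E n.+1)) w.
  move=> /res_diff_exact[u uw]; exists u.
  by apply: (@sincl_inj _ _ _ (submod_kernel (res_diff E n.+1))); rewrite gP.
Qed.

Lemma ann_H_syzygy s n i :
  annihilator (cech_coh s n.+1 (syzygy i)) = annihilator (cech_coh s 1 (syzygy (n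
    + i))).
Proof.
elim: n i => [|n IH] i //.
have [g [fg _]] := syzygy_ses i.
rewrite -(ann_dimension_shift fg); first by rewrite IH addnS.
  exact/H_injective_trivial/res_injective.
exact/H_injective_trivial/res_injective.
Qed.

(** Shifting n times reaches H^1 of the n-th cosyzygy, which [ann_H1] describes by the torsion of
    the next cosyzygy modulo the image of the torsion of E^n; these are the cocycles and boundaries
    of the torsion complex in degree n + 1. *)
Lemma annihilator_local_cohomology s n :
  annihilator (local_cohomology (ideal_gen [set` s]) E n.+1) = annihilator
    (cech_coh s n.+1 M).
Proof.
rewrite (ann_H_syzygy s n 0) addn0.
have [g [fg gE]] := syzygy_ses n.
rewrite (ann_H1 fg); last exact/H_injective_trivial/res_injective.
rewrite annihilator_subquotient; apply/seteqP; split=> r /= rk.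
  move=> c ctors.
  have tc : torsion_set (ideal_gen [set` s]) (syzygy_incl n.+1 c).
    apply/torsion_setP => x /ctors[k kc]; exists k.
    by rewrite -linearZ_LR kc linear0.
  pose z : torsion (ideal_gen [set` s]) (res_module E n.+1) :=
    SubmoduleType (mem_set tc :
      _ \in submodule_mem (Submodule (torsion_closed _ _))).
  have [|w _ wz] := rk z.
    apply: val_inj => /=; exact:
      (@sinclP _ _ _ (submod_kernel (res_diff E n.+1)) c).
  exists (val w); split; first exact/torsion_setP/set_mem/(valP w).
  apply: (@sincl_inj _ _ _ (submod_kernel (res_diff E n.+1))).
  by have := gE (val w); rewrite /= => ->; have := congr1 val wz;
    rewrite /= linearZ_LR.
move=> z /(congr1 val)/= dz.
have [c cz] := sincl_surj (submod_kernel (res_diff E n.+1)) dz.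
have /torsion_setP ztors := set_mem (valP z).
have [|b [/torsion_setP btors bE]] := rk c.
  move=> x /ztors[k kz]; exists k.
  apply: (@sincl_inj _ _ _ (submod_kernel (res_diff E n.+1))).
  by rewrite linearZ_LR cz kz linear0.
exists (SubmoduleType (mem_set btors :
  _ \in submodule_mem (Submodule (torsion_closed _ _)))) => //.
apply: val_inj => /=; rewrite -gE bE linearZ_LR /=.
by rewrite cz.
Qed.

End Resolution.
End DerivedFunctor.

(** * Artinian modules *)

Section Artinian.
Variable R : comNzRingType.
Implicit Types (M N A B C : lmodType R).

Definition artinian M : Prop := forall S : nat -> set M,
  (forall n, submod (S n)) -> (forall n, S n.+1 `<=` S n) ->
  exists n, forall k, (n <= k)%N -> S n `<=` S k.

Lemma descending_le (T : Type) (S : nat -> set T) : (forall n, S n.+1 `<=` S n) ->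
  forall n k, (n <= k)%N -> S k `<=` S n.
Proof.
move=> Sle n k /subnK <-; elim: (k - n)%N => [|j IH]; first by rewrite add0n.
by rewrite addSn; apply: subset_trans (Sle _) IH.
Qed.

Lemma artinian_ext A B C (f : {linear A -> B}) (g : {linear B -> C}) :
  (forall b, g b = 0 -> exists a, f a = b) ->
  artinian A -> artinian C -> artinian B.
Proof.
move=> ex AA AC S SP Sle.
have [||i iP] := AA (fun n => f @^-1` S n).
- by move=> n; apply: submod_preimage.
- by move=> n u /= /Sle.
have [||j jP] := AC (fun n => g @` S n).
- by move=> n; apply: submod_image.
- by move=> n; apply/image_subset/Sle.
exists (maxn i j) => k; rewrite geq_max => /andP[ik jk] u Su.
have [w Sw wu] : (g @` S k) (g u).
  by apply: jP => //; exists u => //; apply: (descending_le Sle (leq_maxr i j)).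
have [|a au] := ex (u - w); first by rewrite linearB wu subrr.
rewrite -(subrK w u) -au; apply: submodD => //.
apply: (iP _ ik); rewrite /preimage/= au; apply: submodB => //.
  exact: (descending_le Sle (leq_maxl i j)).
exact: (descending_le Sle ik).
Qed.

Lemma artinian_trivial A : trivial_mod A -> artinian A.
Proof.
move=> A0 S SP Sle; exists 0%N => k _ u _.
by rewrite (A0 u); apply: submod0.
Qed.

Lemma artinian_surj A B (f : {linear A -> B}) : (forall b, exists a, f a = b) ->
  artinian A -> artinian B.
Proof.
move=> fs AA.
by apply: (artinian_ext (g := zmap B (zero_mod R))) AA (artinian_trivial
  (@zmod_trivial R)) => b _.
Qed.

Lemma artinian_inj A B (f : {linear A -> B}) : injective f ->
  artinian B -> artinian A.
Proof.
move=> finj AB.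
apply: (artinian_ext (f := zmap (zero_mod R) A) (g := f)) (artinian_trivial
  (@zmod_trivial R)) AB => b fb.
by exists 0; apply: finj; rewrite fb linear0 linear0.
Qed.

(* Melkersson's criterion *)
Lemma artinian_torsion M x (MT : submod [set u : M | x *: u = 0]) :
  (forall u : M, exists k, x ^+ k *: u = 0) -> artinian (subm MT) -> artinian M.
Proof.
move=> tors AT S SP Sle.
(* D k n is the intersection of x^k S_n with the kernel of x; it decreases in k and in n. *)
pose D k n : set (subm MT) := [set u | exists2 w, S n w & x ^+ k *: w = sincl MT u].
have DP k n : submod (D k n).
  split=> [|r u u' [w Sw wu] [w' Sw' wu']].
    by exists 0; rewrite ?scaler0 ?linear0 //; apply: submod0.
  exists (r *: w + w'); first exact: (SP n).2.
  by rewrite linearP -wu -wu' scalerDr !scalerA mulrC.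
have Dn k n : D k n.+1 `<=` D k n by move=> u [w /Sle Sw wu]; exists w.
have Dk k n : D k.+1 n `<=` D k n.
  move=> u [w Sw wu]; exists (x *: w); first exact: submodZ.
  by rewrite scalerA -exprSr.
have Dle k k' n n' : (k <= k')%N -> (n <= n')%N -> D k' n' `<=` D k n.
  move=> kk' nn'; apply: (subset_trans (B := D k n')).
    exact: (descending_le (Dk^~ n') kk').
  exact: (descending_le (Dn k) nn').
have [||i iP] := AT (fun n => D n n).
- by move=> n; apply: DP.
- by move=> n; apply: Dle.
have [h hP] := choice (fun k => AT (D k) (DP k) (Dn k)).
(* The diagonal is stationary from i on, which settles all rows k >= i together; each of the
   finitely many rows k < i is stationary from h k on. Hence every row is stationary from N on. *)
pose N := (i + \max_(k < i) h k)%N.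
have stab k n : (N <= n)%N -> D k N `<=` D k n.
  move=> Nn; have [ki|ik] := ltnP k i.
    apply: (subset_trans (B := D k (h k))).
      apply: Dle => //; apply: leq_trans (leq_addl i _).
      exact: (leq_bigmax (F := fun k : 'I_i => h k) (Ordinal ki)).
    apply: hP; apply: leq_trans Nn; apply: leq_trans (leq_addl i _).
    exact: (leq_bigmax (F := fun k : 'I_i => h k) (Ordinal ki)).
  apply: (subset_trans (B := D i i)).
    by apply: Dle => //; apply: leq_addr.
  apply: (subset_trans (B := D (maxn k n) (maxn k n))).
    by apply: iP; rewrite leq_max ik.
  by apply: Dle; rewrite ?leq_maxl ?leq_maxr.
exists N => n Nn u Su.
(* If x^(k+1) kills u, subtracting an element of S n with the same multiple by x^k leaves an element
   killed by x^k. *)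
have [k ku] := tors u; elim: k u Su ku => [|k IH] u Su.
  by rewrite scale1r => ->; apply: submod0.
rewrite exprS -scalerA => /(sincl_surj MT)[v vE].
have [w Sw wu] : D k n v by apply: stab => //; exists u.
rewrite -(subrK w u); apply: submodD => //; apply: IH.
  by apply: submodB => //; apply: (descending_le Sle Nn).
by rewrite scalerBr wu vE subrr.
Qed.

Lemma artinian_power_stable M x : artinian M ->
  exists t, forall u : M, exists w, x ^+ t *: u = x ^+ t.+1 *: w.
Proof.
move=> AM; have [||t tP] := AM (fun n => [set x ^+ n *: u | u in [set: M]]).
- by move=> n; exact: (submod_image (smul M (x ^+ n)) (@submod_setT R M)).
- by move=> n _ [u _ <-]; exists (x *: u); rewrite // scalerA -exprSr.
exists t => u; have [|w _ wu] := tP t.+1 (leqnSn t) (x ^+ t *: u);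
  first by exists u.
by exists w.
Qed.

End Artinian.

(** * Vanishing above the dimension and Artinian cohomology *)

Section Local.
Variable R : comNzRingType.
Hypothesis NR : noeth (R^o : lmodType R).
Variable m : set R.
Hypothesis mP : primei m.
Hypothesis mmax : forall I, ideal I -> ~ I 1 -> I `<=` m.
Implicit Types (M N A B C : lmodType R).
Variable s : seq R.
Hypothesis sm : forall x, x \in s -> m x.

Definition xquo M x : lmodType R := quom (submod_image (smul M x) (@submod_setT R
  M)).
Definition xpi M x : {linear M -> xquo M x} := quo _.

Lemma xquo_ses M x : injective (smul M x) -> ses (smul M x) (xpi M x).
Proof. exact: ses_image. Qed.

Lemma xpi_eq0 M x u : xpi M x u = 0 <-> exists w, x *: w = u.
Proof. by rewrite quo_eq0; split=> [[w _ <-]|[w <-]]; exists w. Qed.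

Lemma xpi_surj M x u : exists w, xpi M x w = u.
Proof. exact: quo_surj. Qed.

Lemma noeth_xquo M x : noeth M -> noeth (xquo M x).
Proof. by apply: noeth_surj; apply: xpi_surj. Qed.

Lemma ann_surj M N (f : {linear M -> N}) : (forall y, exists x, f x = y) ->
  annihilator M `<=` annihilator N.
Proof. by move=> fs r rM y; have [u <-] := fs y;
  rewrite -linearZ_LR rM linear0. Qed.

Lemma ann_inj M N (f : {linear M -> N}) : injective f ->
  annihilator N `<=` annihilator M.
Proof. by move=> fi r rN y; apply: fi; rewrite linearZ_LR rN linear0. Qed.

Lemma ann_xquo M x : annihilator M `<=` annihilator (xquo M x).
Proof. exact/ann_surj/xpi_surj. Qed.

Lemma ann_xquo_x M x : annihilator (xquo M x) x.
Proof.
move=> u; have [w <-] := xpi_surj u.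
by rewrite -linearZ_LR; apply/xpi_eq0; exists w.
Qed.

Lemma smul_inj M x : (forall u : M, x *: u = 0 -> u = 0) -> injective (smul M x).
Proof. by move=> xi; apply: inj_lin0. Qed.

Lemma scale_exp_inj M x k (u : M) : injective (smul M x) -> x ^+ k *: u = 0 ->
  u = 0.
Proof.
move=> xi; elim: k u => [|k IH] u; first by rewrite scale1r.
by rewrite exprS -scalerA => xu; apply/IH/xi; rewrite /= xu scaler0.
Qed.

Lemma Hm_smul n M x (xi : cech_coh s n M) : cech_map s n (smul M x) xi = x *: xi.
Proof. exact: Hm_scale. Qed.

Lemma H_torsion_free_trivial n M x y : x \in s ->
  (forall u : cech_coh s n M, (x * y) *: u = 0 -> u = 0) ->
    trivial_mod (cech_coh s n M).
Proof.
move=> xs xi u; have [k ku] := H_torsion u xs.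
apply: (@scale_exp_inj _ (x * y) k); first exact: smul_inj.
by rewrite exprMn mulrC -scalerA ku scaler0.
Qed.

Lemma cyclic_regular C (v : C) x : primei (annv v) ->
  (forall u, exists r, r *: v = u) -> ~ annv v x -> injective (smul C x).
Proof.
move=> [_ _ pM] vgen px; apply: smul_inj => u.
have [r <-] := vgen u; rewrite scalerA => /pM[//|].
exact.
Qed.

Lemma prime_seq_dec p : (forall x, x \in s -> p x) \/ exists2 x, x \in s & ~ p x.
Proof.
have [|] := pselect (forall x, x \in s -> p x); first by left.
by move=> /existsNP[x /not_implyP[xs px]]; right; exists x.
Qed.

Lemma cyclic_torsion_trivial C (v : C) n : (forall u, exists r, r *: v = u) ->
  (forall x, x \in s -> annv v x) -> trivial_mod (cech_coh s n.+1 C).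
Proof.
move=> vgen sp; apply: H_torsion_trivial => x /sp xv u; exists 1%N.
by have [r <-] := vgen u; rewrite expr1 scalerA mulrC -scalerA xv scaler0.
Qed.

(** Devissage reduces to R/p. If p misses some x in s, then x is regular and dim R/(p + (x)) drops,
    so by induction x is injective on a cohomology module that is also x-torsion. *)
Lemma H_vanish n M i : noeth M -> dim_lt n (annihilator M) -> (n <= i)%N ->
  trivial_mod (cech_coh s i M).
Proof.
elim: n M i => [|n IH] M i NM dM.
  move=> _; apply: (devissage NR mP mmax (Q := fun N => trivial_mod (cech_coh s i
    N))) NM _.
  - by move=> N; apply: H_trivial.
  - by move=> A B C f g fg; exact: (H_trivial_ext fg).
  by move=> C v vP Mv _ _; case: (dM (annv v)).
case: i => [//|i]; rewrite ltnS => ni.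
apply: (devissage NR mP mmax (Q := fun N => trivial_mod (cech_coh s i.+1 N))) NM _.
- by move=> N; apply: H_trivial.
- by move=> A B C f g fg; exact: (H_trivial_ext fg).
move=> C v vP Mv vgen NC; have [sp|[x xs px]] := prime_seq_dec (annv v).
  exact: cyclic_torsion_trivial vgen sp.
have xinj := cyclic_regular vP vgen px.
have vC : annv v `<=` annihilator C.
  by move=> r rv u; have [t <-] := vgen u;
    rewrite scalerA mulrC -scalerA rv scaler0.
have dQ : dim_lt n (annihilator (xquo C x)).
  apply: (@dim_lt_regular _ NR n (annv v) _ x 1).
  - exact: ideal_annv.
  - by apply: (subset_trans vC); apply: ann_xquo.
  - by rewrite expr1; apply: ann_xquo_x.
  - by case: vP => _ _ pM r /pM[].
  - exact: dim_lt_sub Mv dM.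
have Q0 := IH _ _ (noeth_xquo NC) dQ ni.
apply: (@H_torsion_free_trivial _ _ x 1) => // u; rewrite mulr1 -Hm_smul => xu.
apply: (@Hm_inj _ _ _ _ _ _ _ (xquo_ses xinj)); last by rewrite xu linear0.
by move=> z; exists 0; rewrite (Q0 z) linear0.
Qed.

Lemma Hm_top_surj n B C (g : {linear B -> C}) : (forall c, exists b, g b = c) ->
  noeth B -> dim_lt n.+1 (annihilator B) ->
    forall z, exists y, cech_map s n g y = z.
Proof.
move=> gs NB dB.
have fg : ses (sincl (submod_kernel g)) g.
  split=> //; first exact: sincl_inj.
  move=> b; split; first by move/(sincl_surj (submod_kernel g)).
  by move=> [a <-]; exact: (@sinclP _ _ _ (submod_kernel g) a).
apply: (Hm_surj fg); apply: (@H_vanish n.+1) => //.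
  exact: noeth_inj (@sincl_inj _ _ _ _) NB.
by apply: dim_lt_sub dB; apply: ann_inj (@sincl_inj _ _ _ _).
Qed.

(* On M the ideal generated by s has the same radical as m. *)
Definition cofinite M : Prop := forall p, primei p -> annihilator M `<=` p ->
  (forall x, x \in s -> p x) -> m `<=` p.

Lemma cofinite_sub M N : annihilator M `<=` annihilator N -> cofinite M ->
  cofinite N.
Proof. by move=> MN cM p pP Np; apply: cM => //; apply: subset_trans Np. Qed.

(** For R/p with x in s outside p, the kernel of x on H^(i+1) is a quotient of H^i modulo x,
    Artinian by induction, and the cohomology is x-torsion; [artinian_torsion] applies. *)
Lemma H_artinian i M : noeth M -> cofinite M -> artinian (cech_coh s i M).
Proof.
elim: i M => [|i IH] M NM cM;
  apply: (devissage NR mP mmax (Q := fun N => artinian (cech_coh s _ N))) NM _.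
- by move=> N N0; apply/artinian_trivial/H_trivial.
- move=> A B C f g fg; apply:
  (artinian_ext (f := cech_map s 0 f) (g := cech_map s 0 g)) => b.
  by move/(H_exact fg).
- move=> C v vP Mv vgen NC; have [sp|[x xs px]] := prime_seq_dec (annv v).
    apply: artinian_inj (@H0_incl_inj _ s C) _.
    have vm := cM _ vP Mv sp.
    (* Here [annv v] contains m, so C is simple. *)
    have all S u : submod S -> S u -> u <> 0 -> forall w : C, S w.
      move=> SP Su u0 w; have [r ru] := vgen u; have [t <-] := vgen w.
      apply: submodZ => //; apply: contrapT => Sv; apply: u0; rewrite -ru.
      apply: vm; apply: (mmax (I := [set k | S (k *: v)])).
      - split=> [|k a b Sa Sb] /=; first by rewrite scale0r; apply: submod0.
        by rewrite scalerDl -scalerA; apply: SP.2.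
      - by rewrite /= scale1r.
      - by rewrite /= ru.
    move=> S SP Sle.
    have [[n Sn]|nS] := pselect (exists n, forall u, S n u -> u = 0).
      by exists n => k _ u /Sn ->; apply: submod0.
    exists 0%N => k _ u _; apply: contrapT => Sku; apply: nS; exists k => w Sw.
    by apply: contrapT => w0; apply: Sku; apply: all (SP k) Sw w0 _.
  apply: artinian_trivial.
  apply: (@H_torsion_free_trivial _ _ x 1) => // u; rewrite mulr1 => xu.
  apply: (@H0_incl_inj _ s C); apply: (cyclic_regular vP vgen px).
  by rewrite /= -!(linearZ_LR (H0_incl s C)) xu scaler0.
- by move=> N N0; apply/artinian_trivial/H_trivial.
- move=> A B C f g fg; apply:
  (artinian_ext (f := cech_map s i.+1 f) (g := cech_map s i.+1 g)) => b.
  by move/(H_exact fg).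
move=> C v vP Mv vgen NC; have [sp|[x xs px]] := prime_seq_dec (annv v).
  exact/artinian_trivial/(cyclic_torsion_trivial vgen sp).
have fg := xquo_ses (cyclic_regular vP vgen px).
have vC : annv v `<=` annihilator C.
  by move=> r rv u; have [t <-] := vgen u;
    rewrite scalerA mulrC -scalerA rv scaler0.
have AQ : artinian (cech_coh s i (xquo C x)).
  apply: IH; first exact: noeth_xquo.
  by apply: cofinite_sub cM; apply: subset_trans Mv (subset_trans vC _);
    apply: ann_xquo.
apply: (artinian_torsion (MT := submod_kernel (smul (cech_coh s i.+1 C) x))) =>
  [u|].
  exact: H_torsion.
have [|||del delP] := @linear_of_rel _ _ _ (connecting (s := s) (smul C x) (xpi C
  x) (n := i)).
- exact: connecting_ex.
- by move=> r z z' a a'; apply: connectingL.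
- by move=> a /(connecting_uniq fg (connecting0 s fg i)).
have delker z : smul (cech_coh s i.+1 C) x (del z) = 0.
  by rewrite /= -Hm_smul; apply/(connecting_ker fg); exists z.
have [del' del'P] := corestr_ex (submod_kernel (smul (cech_coh s i.+1 C) x)) delker.
apply: (artinian_surj (f := del')) AQ => b.
have := @sinclP _ _ _ (submod_kernel (smul (cech_coh s i.+1 C) x)) b.
rewrite /= -Hm_smul => /(connecting_ker fg)[z zb]; exists z.
apply: (@sincl_inj _ _ _ (submod_kernel (smul (cech_coh s i.+1 C) x))).
by rewrite del'P; exact: (connecting_uniq fg (delP z) zb).
Qed.

End Local.

(** * Top cohomology of full-dimensional submodules *)

Section TopNonzero.
Variable R : comNzRingType.
Hypothesis NR : noeth (R^o : lmodType R).
Variable m : set R.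
Hypothesis mP : primei m.
Hypothesis mmax : forall I, ideal I -> ~ I 1 -> I `<=` m.
Implicit Types (M N A B C : lmodType R).
Variable s : seq R.
Hypothesis sm : forall x, x \in s -> m x.

Lemma ann_annv M (v : M) : annihilator M `<=` annv v.
Proof. by move=> r rM; apply: rM. Qed.

Lemma annv_inj M N (f : {linear M -> N}) (v : M) : injective f ->
  annv (f v) = annv v.
Proof.
move=> fi; apply/seteqP; split=> r /=; rewrite /annv/= -linearZ_LR.
  by move=> rv; apply: fi; rewrite rv linear0.
by move=> ->; rewrite linear0.
Qed.

(* A submodule maximal among those meeting the span of w trivially. *)
Lemma ex_essential_quotient M (w : M) : noeth M ->
  exists (N : lmodType R) (f : {linear M -> N}),
    [/\ forall y, exists x, f x = y, annv (f w) = annv w &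
    forall x, primei (annv w) -> ~ annv w x -> injective (smul N x)].
Proof.
move=> NM; pose P (L : set M) := submod L /\ forall r, L (r *: w) -> r *: w = 0.
have [||L [[LP Lw] Lmax]] := NM P.
- by exists [set 0]; split=> //; apply: submod_set0.
- by move=> L [].
exists (quom LP), (quo LP); split; first exact: quo_surj.
  apply/seteqP; split=> r /=; rewrite /annv/= -linearZ_LR.
    by move/quo_eq0/Lw.
  by move=> ->; rewrite linear0.
move=> x [_ _ pM] px; apply: smul_inj => u.
have [u0 <-] := quo_surj u; rewrite -linearZ_LR => /quo_eq0 Lu; apply/quo_eq0.
(* The preimage of L under x also meets the span of w trivially, because [annv w] is a prime that
   misses x. *)
suff <- : smul M x @^-1` L = L by [].
apply: Lmax; last by move=> z Lz; apply: submodZ.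
split; first exact: submod_preimage.
move=> r; rewrite /preimage/= scalerA => /Lw; rewrite mulrC => /pM[//|]; exact.
Qed.

Lemma Hm_top_nonzero d M N (f : {linear N -> M}) p0 :
  injective f -> noeth M -> cofinite m s M -> dim_lt d.+1 (annihilator M) ->
  pchain d p0 -> annihilator N `<=` p0 -> exists xi, cech_map s d f xi <> 0.
Proof.
elim: d M N f p0 => [|d IH] M N f p0 finj NM cM dM p0n Np0;
  apply: contrapT => /forallNP Hf0.
(* Degree 0: if s lies in p = [annv v], then v is a torsion element not killed by f; otherwise p is
   strictly below m, against the bound on the dimension. *)
- have NN := noeth_inj finj NM.
  have [v0 v0p] := ex_annv_sub NN (pchain_prime p0n) Np0.
  have [t [pP pp0]] := ex_annv_prime NR (pchain_prime p0n) v0p.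
  set v := t *: v0 in pP pp0.
  have [sp|[x xs px]] := prime_seq_dec s (annv v).
    have [|xi xiv] := (H0_incl_img s v).2.
      by move=> x /sp xv; exists 1%N; rewrite expr1.
    apply: (Hf0 xi) => Hxi.
    have : f v = 0 by rewrite -xiv -H0_incl_nat Hxi linear0.
    move=> fv; case: pP => _ + _; apply; rewrite /annv/= scale1r.
    by apply: finj; rewrite fv linear0.
  have pm : annv v `<=` m by case: pP => pI p1 _; apply: mmax.
  apply: (dM (annv v)).
    split=> //; exists m; split=> //; split=> // mp.
    by apply/px/mp/sm.
  by rewrite -(annv_inj _ finj); apply: ann_annv.
have {}Hf0 xi : cech_map s d.+1 f xi = 0 by apply: contrapT; apply: Hf0.
have NN := noeth_inj finj NM.
have [v0 v0p] := ex_annv_sub NN (pchain_prime p0n) Np0.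
have [t0 [pP pp0]] := ex_annv_prime NR (pchain_prime p0n) v0p.
set v := t0 *: v0 in pP pp0.
(* p1 lies strictly above p = [annv v] and carries a chain of length d; it will serve in the
   induction hypothesis. *)
have [_ [p1 [[pp1 p1p] p1n]]] := pchain_sub p0n pP pp0.
have p1P := pchain_prime p1n.
have [M1 [q [qs qv qreg]]] := ex_essential_quotient (f v) NM.
set w := q (f v) in qv.
rewrite (annv_inj _ finj) in qv qreg.
have NM1 := noeth_surj qs NM.
have MM1 := ann_surj qs.
have cM1 := cofinite_sub MM1 cM.
have dM1 := dim_lt_sub MM1 dM.
(* Otherwise cofiniteness puts m inside p, which is strictly below p1. *)
have [y ys py] : exists2 y, y \in s & ~ annv v y.
  have [sp|//] := prime_seq_dec s (annv v); exfalso; apply: p1p.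
  have mv : m `<=` annv v.
    apply: (cM _ pP) => //; rewrite -(annv_inj _ finj); exact: ann_annv.
  apply: subset_trans mv; case: p1P => p1I p11 _; exact: mmax.
have [z p1z pz] : exists2 z, p1 z & ~ annv v z.
  by apply: contrapT => H; apply: p1p => z p1z; apply: contrapT => pz; apply: H;
    exists z.
(* x is outside p, hence regular on M1, and inside p1, which keeps p1 in the support of W/xW. *)
pose x := y * z.
have px : ~ annv v x by case: pP => _ _ pM /pM[].
have p1x : p1 x by case: p1P => p1I _ _; apply: idealM.
have xinj := qreg x pP px.
have xkinj k : injective (smul M1 (x ^+ k)).
  by apply: smul_inj => u; apply: scale_exp_inj.
have annreg r : annihilator M1 (r * x) -> annihilator M1 r.
  move=> rx u; apply: xinj; rewrite /= scalerA mulrC rx.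
  by rewrite scaler0.
clearbody x.
(* W is the saturation of the span of w with respect to x *)
pose S k : set M1 := [set u | exists r, x ^+ k *: u = r *: w].
have SP k : submod (S k).
  split=> [|r u u' [a ua] [b ub]]; first by exists 0; rewrite scaler0 scale0r.
  exists (r * a + b); rewrite scalerDr scalerDl -scalerA -ua -ub !scalerA.
  by rewrite mulrC.
have [|T ST] := noeth_chain NM1 SP.
  move=> k u [r ur]; exists (x * r).
  by rewrite exprS -scalerA ur scalerA.
have WP := SP T; pose W := subm WP; pose iW : {linear W -> M1} := sincl WP.
have iWinj : injective iW by exact: sincl_inj.
have iWP u : exists r, x ^+ T *: iW u = r *: w by exact: (@sinclP _ _ _ WP u).
have iWs k u r : x ^+ k *: u = r *: w -> exists w', iW w' = u.
  move=> ur; apply: sincl_surj; have [Tk|kT] := leqP T k.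
    by rewrite -(ST _ Tk); exists r.
  exists (x ^+ (T - k) * r); rewrite -scalerA -ur scalerA -exprD subnK //.
  exact: ltnW.
have NW := noeth_inj iWinj NM1.
have dimx C k : noeth C -> annihilator M1 `<=` annihilator C ->
  annihilator C (x ^+ k) -> dim_lt d.+1 (annihilator C).
  by move=> NC MC Cx; apply: (dim_lt_regular NR (ideal_ann M1) MC Cx annreg dM1).
have MW : annihilator M1 `<=` annihilator W by apply: ann_inj iWinj.
(* K = R v embeds in W with quotient killed by x^T, hence of smaller dimension, so H^(d+1)(K) maps
   onto H^(d+1)(W); and K maps to M1 through f, which is zero on cohomology. *)
have HW0 xi : cech_map s d.+1 iW xi = 0.
  pose K := subm (submod_span v); pose iK : {linear K -> N} := sincl _.
  have iKP u : exists r, iK u = r *: v.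
    by have [r _ ru] := @sinclP _ _ _ (submod_span v) u; exists r.
  have KW u : S T (q (f (iK u))).
    have [r ->] := iKP u; exists (x ^+ T * r).
    by rewrite -scalerA (linearZ_LR f) (linearZ_LR q).
  have [phi phiP] := corestr_ex WP (f := q \o f \o iK) KW.
  have phiinj : injective phi.
    apply: inj_lin0 => u phiu; apply: (@sincl_inj _ _ _ (submod_span v)).
    rewrite linear0 -/iK; have [r ru] := iKP u; rewrite ru.
    have : annv w r.
      by rewrite /annv/= /w -(linearZ_LR q) -(linearZ_LR f) -ru; have := phiP u;
        rewrite phiu linear0.
    by rewrite qv.
  have ph_ses := ses_image phiinj; set g := quo _ in ph_ses.
  have [gs gker] : (forall c, exists b, g b = c) /\ forall b, g b = 0 <-> exists
    a, phi a = b.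
    by case: ph_ses.
  have /(H_exact ph_ses)[xi' <-] : cech_map s d.+1 g xi = 0.
    apply: (H_vanish NR mP mmax (n := d.+1)) => //; first exact: noeth_surj gs NW.
    apply: (dimx _ T); first exact: noeth_surj gs NW.
      exact: subset_trans MW (ann_surj gs).
    move=> u; have [b <-] := gs u; rewrite -linearZ_LR; apply/gker.
    have [r rb] := iWP b.
    have [k kE] := sincl_surj (submod_span v) (ex_intro2 _ _ r I erefl :
      [set r *: v | r in setT] (r *: v)).
    exists k; apply: iWinj; rewrite /iW phiP /= linearZ_LR -/iW rb /iK kE.
    by rewrite (linearZ_LR f) (linearZ_LR q).
  rewrite -(@Hm_comp _ _ _ _ _ _ _ _ (q \o f \o iK)); last by move=> u;
    rewrite phiP.
  rewrite (@Hm_comp _ _ _ _ _ _ iK (q \o f)) //.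
  by rewrite (@Hm_comp _ _ _ _ _ _ f q) // Hf0 linear0.
(* t satisfies x^t H^d(M1) = x^(t+1) H^d(M1), so x^t kills the image of H^d(M1) in H^d(M1/x^(t+1)
   M1). By [HW0] the classes coming from W/x^(t+1) W lie in that image. *)
have [t tP] := artinian_power_stable x (H_artinian NR mP mmax (i := d) NM1 cM1).
pose xt := x ^+ t.+1.
have xtinj : injective (smul M1 xt) by exact: xkinj.
have xtWinj : injective (smul W xt).
  apply: smul_inj => u xu; apply: iWinj; apply: xtinj.
  by rewrite /= -!(linearZ_LR iW) xu scaler0.
have sesM := xquo_ses xtinj; have sesW := xquo_ses xtWinj.
have [it itP] : exists it : {linear xquo W xt -> xquo M1 xt},
    forall u, it (xpi W xt u) = xpi M1 xt (iW u).
  have [|it itP] := @quo_lift_ex _ _ _ _ (submod_image (smul W xt) (@submod_setT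
    R W)) (xpi M1 xt \o iW).
    by move=> _ [u _ <-]; apply/xpi_eq0; exists (iW u); rewrite /= linearZ_LR.
  by exists it.
have itkill zeta : x ^+ t *: cech_map s d it zeta = 0.
  have [al zal] := connecting_ex sesW zeta.
  have sq u : iW (smul W xt u) = smul M1 xt (iW u) by rewrite /= linearZ_LR.
  have := connecting_nat sq itP zal; rewrite HW0.
  move=> c0; have [eta <-] := (connecting_eq0 sesM c0).1 erefl.
  have [eta' etaE] := tP eta.
  by rewrite -linearZ_LR etaE -Hm_smul; apply/(H_exact sesM); exists eta'.
(* W / x W embeds in M1 / x^(t+1) M1 through multiplication by x^t *)
have [j jP] : exists j : {linear xquo W x -> xquo M1 xt},
    forall u, j (xpi W x u) = xpi M1 xt (x ^+ t *: iW u).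
  have [|j jP] := @quo_lift_ex _ _ _ _ (submod_image (smul W x) (@submod_setT R W))
      (xpi M1 xt \o (smul M1 (x ^+ t) \o iW)).
    move=> _ [u _ <-]; apply/xpi_eq0; exists (iW u).
    by rewrite /= linearZ_LR scalerA -exprSr.
  by exists j.
have jinj : injective j.
  apply: inj_lin0 => c; have [u <-] := xpi_surj c; rewrite jP.
  move=> /xpi_eq0[u' u'E]; apply/xpi_eq0.
  have xu' : x *: u' = iW u.
    apply: (xkinj t); rewrite /= -u'E scalerA -exprSr //.
  have [r ru] := iWP u.
  (* u' belongs to W because W is saturated with respect to x. *)
  have [|w' w'E] := iWs T.+1 u' r; first by rewrite exprSr -scalerA xu'.
  by exists w'; apply: iWinj; rewrite linearZ_LR w'E.
have [pi piP] : exists pi : {linear xquo W xt -> xquo W x},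
    forall u, pi (xpi W xt u) = xpi W x u.
  have [|pi piP] := @quo_lift_ex _ _ _ _ (submod_image (smul W xt) (@submod_setT
    R W)) (xpi W x).
    by move=> _ [u _ <-]; apply/xpi_eq0; exists (x ^+ t *: u);
      rewrite /= scalerA -exprS.
  by exists pi.
have pis c : exists b, pi b = c.
  by have [u <-] := xpi_surj c; exists (xpi W xt u).
(* j after pi is x^t times [it], hence zero on H^d; and pi is onto on H^d, the top degree for
   modules killed by a power of x. *)
have j0 xi : cech_map s d j xi = 0.
  have NWt := noeth_xquo (x := xt) NW.
  have [|zeta <-] := Hm_top_surj NR mP mmax (s := s) (n := d) pis NWt _ xi.
    apply: (dimx _ t.+1) => //; first exact: subset_trans MW (@ann_xquo _ _ _).
    exact: ann_xquo_x.
  rewrite -(@Hm_comp _ _ _ _ _ _ pi j (smul _ (x ^+ t) \o it)); last first.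
    move=> c; have [u <-] := xpi_surj c.
    by rewrite /= itP piP jP linearZ_LR.
  rewrite (@Hm_comp _ _ _ _ _ _ it (smul _ (x ^+ t))) //.
  by rewrite Hm_smul itkill.
have [|||||xi] := IH (xquo M1 xt) (xquo W x) j p1 jinj; last by rewrite j0.
- exact: noeth_xquo.
- by apply: cofinite_sub cM1; apply: ann_xquo.
- by apply: (dimx _ t.+1); [exact: noeth_xquo|exact: ann_xquo|exact: ann_xquo_x].
- exact: p1n.
move=> r rW.
(* It remains to see that r is in p1 when r W lies in x W. Then r^k w lies in x^k W; since x^T W
   lies in R w, for k = T + 1 this gives r^k - x c in p, and x is in p1. *)
have step k : exists u, r ^+ k *: w = x ^+ k *: iW u.
  elim: k => [|k [u uE]].
    have [|u uE] := iWs 0%N w 1; first by rewrite !scale1r.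
    by exists u; rewrite uE.
  have /xpi_eq0[u' u'E] : xpi W x (r *: u) = 0 by rewrite linearZ_LR rW.
  exists u'; rewrite exprS -scalerA uE scalerA mulrC -scalerA -(linearZ_LR iW) -u'E.
  by rewrite (linearZ_LR iW) scalerA -exprSr.
have [u uE] := step T.+1; have [c cE] := iWP u.
have : annv w (r ^+ T.+1 - x * c).
  by rewrite /annv/= scalerBl uE -scalerA -cE scalerA -exprS subrr.
rewrite qv => /pp1 p1r; have [p1I _ _] := p1P.
apply: (@prime_exp _ _ _ T.+1 p1P).
rewrite -(subrK (x * c) (r ^+ _)); apply: (submodD p1I) => //.
by rewrite mulrC; apply: idealM.
Qed.

End TopNonzero.

(** * Primes of quotient rings, and the maximal ideal *)

Section QuotientRing.

Lemma pchain_preimage (R S : comNzRingType) (f : {rmorphism R -> S}) n (q : set S) :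
  (forall y, exists x, f x = y) -> pchain n q -> pchain n (f @^-1` q).
Proof.
move=> fs.
have primef (p : set S) : primei p -> primei (f @^-1` p).
  move=> [pI p1 pM]; split.
  - split=> [|r x y px py]; rewrite /preimage/=; first by rewrite rmorph0;
    apply: submod0 pI.
    by rewrite /GRing.scale/= rmorphD rmorphM; apply: pI.2.
  - by rewrite /preimage/= rmorph1.
  - by move=> x y; rewrite /preimage/= rmorphM => /pM.
elim: n q => [|n IH] q /= [qP qn]; split; try exact: primef; first by [].
have [q' [[qq' q'q] q'n]] := qn; exists (f @^-1` q'); split; last exact: IH.
split; first by move=> x; apply: qq'.
move=> H; apply: q'q => y; have [x <-] := fs y; exact: H.
Qed.

Lemma quotient_ring_pi (R : comNzRingType) (I : set R) (IP : is_proper_ideal I) :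
  exists f : {rmorphism R -> quotient_ring IP},
    (forall y, exists x, f x = y) /\ forall x, I x -> f x = 0.
Proof.
pose f : R -> quotient_ring IP := \pi_({ideal_quot (ideal_mem IP : idealr R)})%qT.
have fD : zmod_morphism f by move=> x y; exact: rmorphB.
have fM : monoid_morphism f by split; [exact: rmorph1 | move=> x y; exact: rmorphM].
pose g : {rmorphism R -> quotient_ring IP} := HB.pack f
  (GRing.isZmodMorphism.Build _ _ f fD) (GRing.isMonoidMorphism.Build _ _ f fM).
exists g; split=> [y|x Ix].
  by exists (repr y); rewrite /g /= /f reprK.
rewrite -(rmorph0 g); apply/eqP; rewrite /g /= /f -Quotient.idealrBE subr0.
exact/mem_set.
Qed.

Lemma pchain_quotient_ring (R : comNzRingType) (p : set R) (pP :
  is_proper_ideal p) n :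
  prime_chain (quotient_ring pP) n -> exists q, pchain n q /\ p `<=` q.
Proof.
move=> /prime_chainP[q qn]; have [f [fs f0]] := quotient_ring_pi pP.
exists (f @^-1` q); split; first exact: pchain_preimage.
move=> x px; rewrite /preimage/= f0 //.
by have [qI _ _] := pchain_prime qn; apply: submod0 qI.
Qed.

End QuotientRing.

Section LocalRing.
Variables (R : comNzRingType) (m : set R).
Hypothesis NR : noeth (R^o : lmodType R).

Lemma is_proper_idealP (I : set R) : is_proper_ideal I <-> ideal I /\ ~ I 1.
Proof.
split.
  move=> [/set_mem I0 /negP I1 IL]; split.
    by split=> // r x y /mem_set Ix /mem_set Iy; apply/set_mem/IL.
  by move=> ?; apply/I1/mem_set.
move=> [[I0 IL] I1]; split; first exact/mem_set.
  by apply/negP => /set_mem.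
by move=> r x y /set_mem Ix /set_mem Iy; apply/mem_set/IL.
Qed.

Lemma local_ring_max : local_ring m -> forall I, ideal I -> ~ I 1 -> I `<=` m.
Proof.
move=> [_ muniq] I II I1.
have [||J [[JI IJ J1] Jmax]] := NR (P := fun J => [/\ ideal J, I `<=` J & ~ J 1]).
- by exists I; split.
- by move=> J [].
have <- // : J = m.
apply: muniq; split; first by apply/is_proper_idealP.
move=> K /is_proper_idealP[KI K1] JK; apply: Jmax => //; split=> //.
exact: subset_trans JK.
Qed.

Lemma local_ring_prime : local_ring m -> primei m.
Proof.
move=> [[/is_proper_idealP[mI m1] mmax] _].
(* The multiplicative set {1} gives a prime containing m, equal to m by maximality. *)
have [|||q [qP mq _]] := @ex_prime_disjoint _ NR [set 1] m mI.
- by [].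
- by move=> x y /= -> ->; rewrite mulr1.
- by move=> x /= ->.
suff <- : q = m by [].
by apply: mmax => //; apply/is_proper_idealP; case: qP.
Qed.

Lemma ideal_colon (I J : set R) : ideal I -> ideal (colon I J).
Proof.
move=> II; split=> [x _|r x y xJ yJ z Jz]; first by rewrite mul0r;
  apply: submod0 II.
by rewrite mulrDl -mulrA; apply: II.2; [apply: xJ|apply: yJ].
Qed.

Lemma ideal_gen_nil : ideal_gen [set` ([::] : seq R)] = [set 0].
Proof.
apply/seteqP; split.
  by apply: ideal_gen_sub; [exact: (submod_set0 (R^o : lmodType R))|].
by have [G0 _] := ideal_genP [set` ([::] : seq R)]; move=> _ ->.
Qed.

End LocalRing.

(** * The annihilator of top cohomology *)

Section Annihilator.
Variable R : comNzRingType.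
Hypothesis NR : noeth (R^o : lmodType R).
Variable m : set R.
Hypothesis mP : primei m.
Hypothesis mmax : forall I, ideal I -> ~ I 1 -> I `<=` m.
Implicit Types (M N A B C : lmodType R) (a b : set R).
Variable s : seq R.
Hypothesis sm : forall x, x \in s -> m x.

Lemma ann_H_torsion_multiple M n x :
  (forall y, y \in s -> forall u : M, y *: (x *: u) = 0) ->
    annihilator (cech_coh s n.+1 M) x.
Proof.
move=> sx xi; rewrite -Hm_smul.
have KP := submod_image (smul M x) (@submod_setT R M).
have [f fE] := corestr_ex (f := smul M x) KP (fun u => ex_intro2 _ _ u I erefl).
rewrite (@Hm_comp _ _ _ _ _ _ f (sincl KP) (smul M x)) => [|u]; last by rewrite fE.
suff K0 : trivial_mod (cech_coh s n.+1 (subm KP)) by rewrite (K0 (cech_map _ _ _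
  _)) linear0.
apply: H_torsion_trivial => y ys u; exists 1%N.
apply: (@sincl_inj _ _ _ KP); rewrite linear0 linearZ_LR expr1.
by have [w _ <-] := @sinclP _ _ _ KP u; apply: sx.
Qed.

(** The proof that S is a submodule is hidden under the existential so that this is a family of
    sets, as [noeth] expects. *)
Definition zero_image d M (S : set M) : Prop := exists SP : submod S,
  forall xi : cech_coh s d (subm SP), cech_map s d (sincl SP) xi = 0.

Lemma zero_image_trivial d M (S : set M) (SP : submod S) (K :
  set (quom SP)) (KP : submod K) :
  zero_image d S -> trivial_mod (cech_coh s d (subm KP)) ->
  zero_image d (quo SP @^-1` K).
Proof.
move=> [SP' S0] K0; rewrite (Prop_irrelevance SP' SP) in S0.
have [f [g [fg fE gE]]] := ses_preimage KP.
exists (submod_preimage (quo SP) KP) => xi.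
have /(H_exact fg)[eta <-] :
  cech_map s d g xi = 0 by rewrite (K0 (cech_map _ _ _ _)).
by rewrite -(@Hm_comp _ _ _ _ _ _ _ _ (sincl SP)) // => x; rewrite fE.
Qed.

(** The enlarged submodule is S + c M. By right exactness H^d(S) and H^d(M), the latter through
    multiplication by c, together cover its top cohomology, and both die in H^d(M). *)
Lemma zero_image_ann d M (S : set M) (SP : submod S) c
    (KP := submod_image (quo SP \o smul M c) (@submod_setT R M)) :
  noeth M -> dim_lt d.+1 (annihilator M) -> annihilator (cech_coh s d M) c ->
  zero_image d S -> zero_image d (quo SP @^-1` [set (quo SP \o smul M c) u | u in
    setT]).
Proof.
move=> NM dM cH [SP' S0]; rewrite (Prop_irrelevance SP' SP) in S0.
have [f [g [fg fE gE]]] := ses_preimage KP.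
set LP := submod_preimage (quo SP) KP in f g fg fE gE.
exists LP => xi.
have [phi phiE] := corestr_ex (f := smul M c) LP (fun u => ex_intro2 _ _ u I erefl).
have gphi y : exists u, (g \o phi) u = y.
  have [u _ uE] := @sinclP _ _ _ KP y; exists u; apply: (@sincl_inj _ _ _ KP).
  by rewrite /= gE phiE.
have [zeta zE] := Hm_top_surj NR mP mmax (s := s) gphi NM dM (cech_map s d g xi).
have /(H_exact fg)[eta etaE] : cech_map s d g (xi - cech_map s d phi zeta) = 0.
  by rewrite linearB -(@Hm_comp _ _ _ _ _ _ _ _ (g \o phi)) // zE subrr.
rewrite -(subrK (cech_map s d phi zeta) xi) -etaE linearD.
rewrite -(@Hm_comp _ _ _ _ _ _ _ _ (sincl SP)) => [|x]; last by rewrite fE.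
rewrite -(@Hm_comp _ _ _ _ _ _ _ _ (smul M c)) => [|x]; last by rewrite phiE.
by rewrite S0 Hm_smul cH addr0.
Qed.

(** A maximal S absorbs the two enlargements above; for M = R it is the annihilator of H^d. *)
Lemma ex_max_zero_image d M : noeth M -> dim_lt d.+1 (annihilator M) ->
  exists (S : set M) (SP : submod S),
    [/\ zero_image d S, forall c u, annihilator (cech_coh s d M) c -> S (c *: u)
      & forall (K : set (quom SP)) (KP :
        submod K), trivial_mod (cech_coh s d (subm KP)) ->
          forall u, K u -> u = 0].
Proof.
move=> NM dM; have [||S [SZ Smax]] := NM (zero_image d (M := M)).
- exists [set 0], (submod_set0 M) => xi; rewrite (_ : xi = 0) ?linear0 //.
  apply: H_trivial => u; apply: (@sincl_inj _ _ _ (submod_set0 M)).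
  by rewrite linear0; apply: (@sinclP _ _ _ (submod_set0 M) u).
- by move=> S [].
have [SP _] := SZ; exists S, SP; split=> //.
  move=> c u cH; rewrite -(Smax _ (zero_image_ann SP NM dM cH SZ)).
    by exists u.
  by move=> x Sx; exists 0 => //=; rewrite scaler0 linear0; apply/esym/quo_eq0.
move=> K KP K0 u; have [w <-] := quo_surj u => Kw; apply/quo_eq0.
rewrite -(Smax _ (zero_image_trivial SZ K0)) // => x /(quo_eq0 SP) Sx.
by rewrite /preimage/= Sx; apply: submod0.
Qed.

(** Used to separate r from the radical of c by the annihilator of a single element of R: a prime
    associated to R/c that misses r has dimension d, so it is minimal and therefore associated to R
    as well. *)
Lemma ex_assoc_prime d r :
  (forall n (p : set R), pchain n p -> (n <= d)%N) ->
  ~ radical (annihilator (cech_coh s d (R^o : lmodType R))) r ->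
  exists y : R, [/\ primei (annv (y : R^o)), annihilator (cech_coh s d (R^o :
    lmodType R)) `<=` annv (y : R^o)
    & ~ annv (y : R^o) r].
Proof.
move=> dR rJ; set c := annihilator _ in rJ *.
have dM (I : set R) : dim_lt d.+1 I by move=> p /dR; rewrite ltnn.
have [S [SP [SZ cS Kt]]] := ex_max_zero_image NR (dM _).
have Sc x : S x -> c x.
  move=> Sx xi; rewrite -Hm_smul.
  have Sxu u : S (smul (R^o : lmodType R) x u).
    by rewrite /= /GRing.scale/= mulrC; apply: (submodZ SP).
  have [f fE] := corestr_ex SP Sxu; have [SP' S0] := SZ.
  rewrite (Prop_irrelevance SP' SP) in S0.
  by rewrite (@Hm_comp _ _ _ _ _ _ f (sincl SP)) // S0.
have {}cS x : c x -> S x by move=> cx; have := cS x 1 cx;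
  rewrite /GRing.scale/= mulr1.
(* With k in the stable range, r cannot kill a nonzero multiple of r^k modulo S, so the prime found
   below misses r. *)
have [k kP] := stable_annihilator r SP NR.
have rk : ~ S (r ^+ k) by move=> /Sc h; apply: rJ; exists k.
have [|t [pP _]] := @ex_annv_prime _ NR _ (quo SP (r ^+ k)) m mP.
  apply: mmax; first exact: ideal_annv.
  by rewrite /annv/= scale1r => /quo_eq0.
set v := t *: quo SP _ in pP.
have vE l : annv v l <-> S (l * (t * r ^+ k)).
  rewrite /annv /v /= -!(linearZ_LR (quo SP)); exact: quo_eq0.
have pr : ~ annv v r.
  move=> /vE h; case: pP => _ + _; apply; apply/vE; rewrite mul1r mulrC.
  apply: (kP k.+1) => //; rewrite /GRing.scale/= exprS.
  by rewrite mulrC mulrCA.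
have cp : c `<=` annv v.
  by move=> x /cS Sx; apply/vE; rewrite mulrC; apply: (submodZ SP).
(* Otherwise the span of v would have dimension below d, hence zero H^d, which the choice of S
   excludes. *)
have [p0 [p0n pp0]] : exists p0, pchain d p0 /\ annv v `<=` p0.
  apply: contrapT => np; case: (pP) => _ + _; apply; rewrite /annv/= scale1r.
  apply: (Kt _ (submod_span v)); last by exists 1; rewrite // scale1r.
  apply: (H_vanish NR mP mmax (n := d)) => //.
    exact: noeth_inj (@sincl_inj _ _ _ _) (noeth_surj (@quo_surj _ _ _ SP) NR).
  move=> p0 p0n Kp0; apply: np; exists p0; split=> // l lv; apply: Kp0 => u.
  apply: (@sincl_inj _ _ _ (submod_span v)).
  have [i _ iE] := @sinclP _ _ _ (submod_span v) u.
  by rewrite linear0 linearZ_LR -iE scalerA mulrC -scalerA lv scaler0.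
have pn := pchain_sub p0n pP pp0.
(* Below [annv v] there is a prime associated to R; a strict inclusion would give a chain of length
   d + 1. *)
have [|y [yP yp]] := @ex_annv_prime _ NR (R^o : lmodType R) 1 (annv v) pP.
  move=> l; rewrite /annv/= /GRing.scale/= mulr1 => ->.
  exact: scale0r.
suff E : annv v = annv (y *: (1 : R^o)).
  by rewrite E in pr pP cp; exists (y *: (1 : R^o)).
apply/seteqP; split=> //; apply: contrapT => py.
have : pchain d.+1 (annv (y *: (1 : R^o))) by split=> //; exists (annv v).
by move/dR; rewrite ltnn.
Qed.

(** Since b = 0 : a, a prime that annihilates an element of R/b is associated to R, and the
    hypothesis on associated primes then gives it dimension d. *)
Lemma ann_H_sub d a b : a = ideal_gen [set` s] ->
  (forall n (p : set R), pchain n p -> (n <= d)%N) ->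
  (forall (p : set R) (pP : is_proper_ideal p), associated_prime p ->
    exists q, pchain d q /\ p `<=` q) ->
  b = colon [set 0] a ->
  (forall p, primei p -> a `<=` p -> b `<=` p -> m `<=` p) ->
  annihilator (cech_coh s d (R^o : lmodType R)) `<=` b.
Proof.
move=> aE dR umx bE abm r rH; apply: contrapT => br.
have dM (I : set R) : dim_lt d.+1 I by move=> p /dR; rewrite ltnn.
have sa x : x \in s -> a x by rewrite aE; apply: (@sub_gen_smallest _ _ [set` s]).
have aI : ideal a by rewrite aE; apply: ideal_genP.
have bP : submod (b : set (R^o : lmodType R)).
  by rewrite bE; apply: ideal_colon; exact: (submod_set0 (R^o : lmodType R)).
pose M := quom bP.
have NM : noeth M := noeth_surj (@quo_surj _ _ _ bP) NR.
have [|t [pP _]] := @ex_annv_prime _ NR M (quo bP r) m mP.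
  apply: mmax; first exact: ideal_annv.
  by rewrite /annv/= scale1r => /quo_eq0.
set v := t *: quo bP r in pP.
have vE l : annv v l <-> forall y, a y -> l * (t * r) * y = 0.
  rewrite /annv /v /= -!(linearZ_LR (quo bP)) (quo_eq0 bP) bE; split; exact.
have pproper : is_proper_ideal (annv v).
  by apply/is_proper_idealP; case: pP.
have [q [qn pq]] : exists q, pchain d q /\ annv v `<=` q.
  apply: umx pproper _; split; first exact/is_prime_idealP.
  (* p is the annihilator of the finitely generated ideal (t r) a; being prime, it is the
     annihilator of one of its elements t r y. *)
  have NP := submod_image (smul (R^o : lmodType R) (t * r)) aI.
  have [||w wp] := @ex_annv_sub _ (subm NP) (annv v) _ pP.
  - exact: noeth_inj (@sincl_inj _ _ _ NP) NR.
  - move=> l lN; apply/vE => y ay; rewrite -mulrA.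
    have [w wE] := sincl_surj NP (ex_intro2 _ _ y ay erefl).
    by have := congr1 (sincl NP) (lN w); rewrite linear0 linearZ_LR wE.
  have [y ay yE] := @sinclP _ _ _ NP w; exists (t * r * y).
  apply/seteqP; split=> l.
    by move=> /vE h _ ->; rewrite /= mulrA h.
  move=> /(_ _ erefl) h; apply: wp; apply: (@sincl_inj _ _ _ NP).
  by rewrite linear0 linearZ_LR -yE.
pose KP := submod_span v.
have [||xi Hxi] := @Hm_top_nonzero _ NR m mP mmax s sm d M (subm KP) (sincl KP) q
  (@sincl_inj _ _ _ KP) NM _ (dM _) qn.
- move=> p pP' Mp sp; apply: abm => //.
    by rewrite aE; apply: ideal_gen_sub => //; case: pP'.
  move=> x bx; apply: Mp => u; have [w <-] := quo_surj u.
  rewrite -linearZ_LR; apply/quo_eq0; rewrite /GRing.scale/= mulrC.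
  exact: (submodZ bP).
- move=> l lK; apply: pq.
  have [w wE] := sincl_surj KP (ex_intro2 _ _ 1 I (scale1r v)).
  by rewrite /annv/= -wE -linearZ_LR lK linear0.
(* h is zero on H^d because r kills H^d(R). It is also R -> R v followed by the inclusion, and the
   first of these is onto on H^d. *)
pose h := quo bP \o smul (R^o : lmodType R) (t * r).
have hE k : h k = (k : R) *: v.
  rewrite /h /v /= -!(linearZ_LR (quo bP)); congr (quo bP _).
  by rewrite /GRing.scale/= mulrC.
have [phi phiE] := corestr_ex (f := h) KP (fun k => ex_intro2 _ _ (k :
  R) I (esym (hE k))).
have phis y : exists k, phi k = y.
  have [k _ kE] := @sinclP _ _ _ KP y; exists k.
  by apply: (@sincl_inj _ _ _ KP); rewrite phiE -kE; apply: hE.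
have [zeta zE] := Hm_top_surj NR mP mmax (s := s) phis NR (dM _) xi.
apply: Hxi; rewrite -zE -(@Hm_comp _ _ _ _ _ _ _ _ h) => [|k]; last by rewrite phiE.
rewrite (@Hm_comp _ _ _ _ _ _ (smul (R^o : lmodType R) (t * r)) (quo bP)) //.
by rewrite Hm_smul -scalerA rH scaler0 linear0.
Qed.

End Annihilator.

(** The partner of J is its annihilator, and the regular sequence is empty. *)
Lemma linked_annihilator (R : comNzRingType) (J : set R) :
  ~ J 1 -> J <> [set 0] -> J = colon [set 0] (colon [set 0] J) -> linked_ideal J.
Proof.
move=> J1 J0 JE; set b := colon [set 0] J in JE.
have colonI (K : set R) : ideal (colon [set 0] K).
  exact: (ideal_colon _ (submod_set0 (R^o : lmodType R))).
have JI : ideal J by rewrite JE; apply: colonI.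
have JZ : J 0 := submod0 JI.
exists [set 0], b; split=> //.
- by split=> //; apply/is_proper_idealP.
- split.
    apply/is_proper_idealP; split; first exact: colonI.
    move=> b1; apply: J0; apply/seteqP; split=> [x /b1|_ ->//].
    by rewrite /= mul1r.
  by move=> b0; apply: J1; rewrite JE b0 => _ ->; rewrite mulr0.
- exists [::]; last by rewrite ideal_gen_nil.
  by split=> //; rewrite ideal_gen_nil /=; apply/eqP; apply: oner_neq0.
- by move=> _ ->; split=> //; apply: submod0 (colonI J).
Qed.

Theorem proposition2p12 (R : comNzRingType) (m : set R) (d : nat)
    (E : injective_resolution (R^o : lmodType R)) (a b : set R) :
  noetherian R -> local_ring m -> adically_complete m ->
  krull_dim_is R d -> (0 < d)%N ->
  linked_by [set 0] a b ->
  cd_is a E d ->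
  linked_ideal (radical (annihilator (local_cohomology a E d))) /\
  (unmixed R -> is_primary_to m (ideal_add a b) ->
   annihilator (local_cohomology a E d) = b /\
   annihilator (local_cohomology b E d) = a).
Proof.
move=> noethR localR _ dimR d_gt0 [[apr a0] [bpr b0] _ _ [bE aE]] [[h h0] _].
have NR := noeth_ring noethR.
have mP := local_ring_prime NR localR.
have mmax := local_ring_max NR localR.
have dR n (p : set R) : pchain n p -> (n <= d)%N.
  by move=> pn; apply: dimR.2; apply/prime_chainP; exists p.
have [s sE] := noethR a ((submodP (a : set R^o)).2 ((is_proper_idealP a).1 apr).1).
have [s' s'E] := noethR b ((submodP (b :
  set R^o)).2 ((is_proper_idealP b).1 bpr).1).
(* Annihilators are compared in positive degrees, which is where d > 0 enters. *)
case: d d_gt0 E dimR h h0 dR => [//|d] _ E dimR h h0 dR.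
rewrite [X in local_cohomology X]sE [X in _ /\ (_ -> _ ->
  _ /\ annihilator (local_cohomology X _ _) = _)]s'E.
rewrite !(annihilator_local_cohomology NR).
set ca := annihilator _; set cb := annihilator _.
have sub (t : seq R) (I : set R) : I = ideal_gen [set` t] -> forall x, x \in t ->
  I x.
  by move=> -> x xt; apply: (@sub_gen_smallest _ _ [set` t]).
have kill (t : seq R) (I J : set R) : I = ideal_gen [set` t] ->
  J = colon [set 0] I ->
    J `<=` annihilator (cech_coh t d.+1 (R^o : lmodType R)).
  move=> IE JE x Jx; apply: ann_H_torsion_multiple => y yt u.
  rewrite /GRing.scale/= mulrA [y * x]mulrC; rewrite JE in Jx.
  by rewrite (Jx y) ?mul0r //; apply: sub IE _ yt.
have bca : b `<=` ca := kill _ _ _ sE bE.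
have acb : a `<=` cb := kill _ _ _ s'E aE.
have ca1 : ~ ca 1.
  rewrite /ca -(annihilator_local_cohomology NR E) -sE => h1.
  by move/eqP: h0; apply; rewrite -[h]scale1r h1.
split.
  apply: linked_annihilator.
  - by move=> [n]; rewrite expr1n.
  - move=> J0; apply: b0; apply/seteqP; split.
      by move=> x /bca cx; rewrite -J0; exists 1%N.
    by move=> _ ->; case: ((is_proper_idealP b).1 bpr) => bI _; apply: submod0 bI.
  apply/seteqP; split=> [r Jr y yJ|r rJ].
    by rewrite mulrC; apply: yJ.
  (* The element y supplied for r has a prime annihilator containing c, so the radical of c kills y;
     then r, which kills everything the radical kills, also kills y, a contradiction. *)
  apply: contrapT => Jr.
  have [y [yP cy yr]] := ex_assoc_prime NR mP mmax dR Jr.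
  apply: yr; apply: rJ => x [n cx]; rewrite /= mulrC.
  exact: (prime_exp yP (cy _ cx)).
move=> umx [_ radm].
(* Read at the dimension of R, [unmixed] yields a chain of top length in R/p, pulled back to primes
   above p. *)
have umx' (p : set R) (pP : is_proper_ideal p) : associated_prime p ->
    exists q, pchain d.+1 q /\ p `<=` q.
  move=> pA; have [_ /(_ dimR)[+ _]] := umx _ pP pA d.+1.
  exact: pchain_quotient_ring.
have abm p : primei p -> a `<=` p -> b `<=` p -> m `<=` p.
  move=> pP ap bp x; rewrite -radm => -[n [u au [v bv uv]]].
  apply: (prime_exp (n := n) pP); rewrite -uv; case: pP => pI _ _.
  by apply: (submodD pI); [apply: ap|apply: bp].
have subm' (t : seq R) (I : set R) : I = ideal_gen [set` t] -> is_proper_ideal I ->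
    forall x, x \in t -> m x.
  by move=> IE /is_proper_idealP[II I1] x /(sub _ _ IE); apply: mmax.
split; apply/seteqP; split=> //.
  exact: (ann_H_sub NR mP mmax (subm' _ _ sE apr) sE dR umx' bE abm).
apply: (ann_H_sub NR mP mmax (subm' _ _ s'E bpr) s'E dR umx' aE) => p pP bp ap.
exact: abm.
Qed.
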